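(* Let $G$ be a connected complex semisimple Lie group with Lie algebra $\mathfrak g$, let $M$ be a $G$-manifold with sheaf of functions $\mathcal A$, let $r$ be a classical r-matrix on $\mathfrak g$, and let $U_h(\mathfrak g,r)$ be the corresponding quantum group, defined by $F_h$ with associated element $\Phi_h$. Then there is a natural one-to-one correspondence between $U_h(\mathfrak g,r)$-invariant quantizations of $\mathcal A$ and $U(\mathfrak g)$-invariant $\Phi_h$-associative quantizations of $\mathcal A$. Namely, if $\mu_h$ is a $U(\mathfrak g)$-invariant $\Phi_h$-associative multiplication on $\mathcal A[[h]]$, then $$m_h=\mu_h F_h^{-1},\qquad\text{i.e. } m_h(x\otimes y)=\mu_h\big(F_h^{-1}(x\otimes y)\big),$$ is a $U_h(\mathfrak g,r)$-invariant associative multiplication on $\mathcal A[[h]]$.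
   Context: **Quantum group.** A classical r-matrix is an element $r\in\wedge^2\mathfrak g$ whose Schouten bracket $\varphi=[\![r,r]\!]\in\wedge^3\mathfrak g$ is $\mathfrak g$-invariant. Let $\Delta$ and $\varepsilon$ be the usual comultiplication and counit of $U(\mathfrak g)$. The quantum group $U_h(\mathfrak g,r)$ is $U(\mathfrak g)[[h]]$ as a topological $\mathbb C[[h]]$-algebra, with counit the natural extension of $\varepsilon$ and comultiplication $\Delta_h(x)=F_h\Delta(x)F_h^{-1}$, where $F_h\in U(\mathfrak g)^{\otimes 2}[[h]]$ satisfies $F_h=1\otimes1+\frac h2 r+o(h)$, $(\varepsilon\otimes1)F_h=(1\otimes\varepsilon)F_h=1\otimes 1$ (i.e. is the unit), and $$(F_h\otimes1)\cdot(\Delta\otimes \mathrm{id})(F_h)=(1\otimes F_h)\cdot(\mathrm{id}\otimes\Delta)(F_h)\cdot\Phi_h$$ for an invariant element $\Phi_h\in U(\mathfrak g)^{\otimes3}[[h]]$. One has $\Phi_h=1\otimes1\otimes1+h^2\varphi+o(h^2)$ ($\varphi$ up to a normalizing scalar factor), $\Phi_h$ satisfies the pentagon identity $(\mathrm{id}^{\otimes2}\otimes\Delta)(\Phi_h)\cdot(\Delta\otimes\mathrm{id}^{\otimes2})(\Phi_h)=(1\otimes\Phi_h)\cdot(\mathrm{id}\otimes\Delta\otimes\mathrm{id})(\Phi_h)\cdot(\Phi_h\otimes1)$, and $\Phi_h$ is chosen so that $\Phi_h\Phi_h^s=1$, where $\Phi_h^s=(s\otimes s\otimes s)(\Phi_h)$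 and $s$ is the antipode of $U(\mathfrak g)$ ($s(x)=-x$ for $x\in\mathfrak g$). **Quantizations.** $\mathcal A$ is the sheaf of analytic, smooth or algebraic functions on $M$ (depending on the type of $M$), with usual multiplication $m_0$. $U(\mathfrak g)$ acts on $\mathcal A$, and this action is extended $\mathbb C[[h]]$-linearly to an action of $U(\mathfrak g)[[h]]$ on $\mathcal A[[h]]$. A quantization of $\mathcal A$ is an associative $\mathbb C[[h]]$-linear multiplication $m_h=\sum_{k\ge0}h^km_k$ on $\mathcal A[[h]]$ with $m_0$ the usual multiplication and $m_k$, $k>0$, bidifferential operators vanishing on constants. It is $U_h(\mathfrak g,r)$-invariant if $b\,m_h(x\otimes y)=m_h(\Delta_h(b)(x\otimes y))$ for all $b\in U(\mathfrak g)$, $x,y\in\mathcal A$. A $\mathbb C[[h]]$-linear map $\mu_h:\mathcal A[[h]]\otimes\mathcal A[[h]]\to\mathcal A[[h]]$ is a $\Phi_h$-associative multiplication if, writing $\Phi_h=\Phi_1\otimes\Phi_2\otimes\Phi_3$ (summation implicit), $$\mu_h\big(\Phi_1x\otimes\mu_h(\Phi_2y\otimes\Phi_3z)\big)=\mu_h\big(\mu_h(x\otimes y)\otimes z\big)\quad\text{for all }x,y,z\in\mathcal A.$$ It gives a $\Phi_h$-associative quantization of $\mathcal A$ if $\mu_h=\sum_{k\ge0}h^k\mu_k$ with $\mu_0=m_0$ and $\mu_k$, $k>0$, bidifferential operators vanishing on constants. It is $U(\mathfrak g)$-invariant if $b\,\mu_h(x\otimes y)=\mu_h(\Delta(b)(x\otimes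 y))$ for all $b\in U(\mathfrak g)$. *)

(* Defs.v *)
From HB Require Import structures.
From mathcomp Require Import all_boot all_order all_algebra.
From mathcomp Require Import all_classical all_reals all_analysis.
From mathcomp Require Import generic_quotient perm complex.

Set Implicit Arguments.
Unset Strict Implicit.
Unset Printing Implicit Defensive.

Import Order.TTheory GRing.Theory Num.Theory numFieldNormedType.Exports.

Local Open Scope classical_set_scope.
Local Open Scope ring_scope.
Local Open Scope quotient_scope.

Inductive aexpr (K X : Type) : Type :=
| AGen of X
| AZero
| AOne
| AOpp of aexpr K X
| AScale of K & aexpr K X
| AAdd of aexpr K X & aexpr K X
| AMul of aexpr K X & aexpr K X.
Arguments AGen {K X}.
Arguments AZero {K X}.
Arguments AOne {K X}.

Fixpoint aeval (K : comNzRingType) (X : Type) (B : algType K) (f : X -> B)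
    (t : aexpr K X) : B :=
  match t with
  | AGen x => f x
  | AZero => 0
  | AOne => 1
  | AOpp t => - aeval f t
  | AScale c t => c *: aeval f t
  | AAdd t u => aeval f t + aeval f u
  | AMul t u => aeval f t * aeval f u
  end.

(* The augmentation guarantees that the presented algebra is not trivial, as
   required of an algType; it induces the counit. *)
Record presentation (K : comNzRingType) := Presentation {
  pgen : Type;
  prel : aexpr K pgen -> aexpr K pgen -> Prop;
  paug : pgen -> K^o;
  paugP : forall t u, prel t u -> aeval paug t = aeval paug u
}.

Inductive acong (K : comNzRingType) (P : presentation K) :
    aexpr K (pgen P) -> aexpr K (pgen P) -> Prop :=
| ac_rel t u : prel t u -> acong t u
| ac_refl t : acong t t
| ac_sym t u : acong t u -> acong u t
| ac_trans t u v : acong t u -> acong u v -> acong t v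
| ac_opp t t' : acong t t' -> acong (AOpp t) (AOpp t')
| ac_scale c t t' : acong t t' -> acong (AScale c t) (AScale c t')
| ac_add t t' u u' :
    acong t t' -> acong u u' -> acong (AAdd t u) (AAdd t' u')
| ac_mul t t' u u' :
    acong t t' -> acong u u' -> acong (AMul t u) (AMul t' u')
| ac_addA t u v : acong (AAdd t (AAdd u v)) (AAdd (AAdd t u) v)
| ac_addC t u : acong (AAdd t u) (AAdd u t)
| ac_add0 t : acong (AAdd AZero t) t
| ac_addN t : acong (AAdd (AOpp t) t) AZero
| ac_mulA t u v : acong (AMul t (AMul u v)) (AMul (AMul t u) v)
| ac_mul1t t : acong (AMul AOne t) t
| ac_mult1 t : acong (AMul t AOne) t
| ac_mulDl t u v : acong (AMul (AAdd t u) v) (AAdd (AMul t v) (AMul u v))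
| ac_mulDr t u v : acong (AMul t (AAdd u v)) (AAdd (AMul t u) (AMul t v))
| ac_scaleA a b t : acong (AScale a (AScale b t)) (AScale (a * b) t)
| ac_scale1 t : acong (AScale 1 t) t
| ac_scaleDr a t u :
    acong (AScale a (AAdd t u)) (AAdd (AScale a t) (AScale a u))
| ac_scaleDl a b t :
    acong (AScale (a + b) t) (AAdd (AScale a t) (AScale b t))
| ac_scaleAl a t u : acong (AScale a (AMul t u)) (AMul (AScale a t) u)
| ac_scaleAr a t u : acong (AScale a (AMul t u)) (AMul t (AScale a u)).

HB.instance Definition _ (K X : Type) := gen_eqMixin (aexpr K X).
HB.instance Definition _ (K X : Type) := gen_choiceMixin (aexpr K X).

Section PresentedAlgebra.
Context {K : comNzRingType} (P : presentation K).
Implicit Types t u v : aexpr K (pgen P).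

Lemma aeval_acong (B : algType K) (f : pgen P -> B) :
  (forall t u, prel t u -> aeval f t = aeval f u) ->
  forall t u, acong t u -> aeval f t = aeval f u.
Proof.
move=> fP t u; elim=> //=; clear -fP.
- by move=> t u v _ -> _ ->.
- by move=> t t' _ ->.
- by move=> c t t' _ ->.
- by move=> t t' u u' _ -> _ ->.
- by move=> t t' u u' _ -> _ ->.
- by move=> *; rewrite addrA.
- by move=> *; rewrite addrC.
- by move=> *; rewrite add0r.
- by move=> *; rewrite addNr.
- by move=> *; rewrite mulrA.
- by move=> *; rewrite mul1r.
- by move=> *; rewrite mulr1.
- by move=> *; rewrite mulrDl.
- by move=> *; rewrite mulrDr.
- by move=> *; rewrite scalerA.
- by move=> *; rewrite scale1r.
- by move=> *; rewrite scalerDr.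
- by move=> *; rewrite scalerDl.
- by move=> *; rewrite scalerAl.
- by move=> *; rewrite scalerAr.
Qed.

Definition acongb t u : bool := `[< acong t u >].

Lemma acongb_equiv : equiv_class_of acongb.
Proof.
split=> [t|t u|u t v]; rewrite /acongb.
- by apply/asboolP; exact: ac_refl.
- by apply/asboolP/asboolP; exact: ac_sym.
- by move=> /asboolP tu /asboolP uv; apply/asboolP; exact: ac_trans uv.
Qed.
Canonical acong_equivRel := EquivRelPack acongb_equiv.

Definition presAlg : Type := {eq_quot acong_equivRel}.
HB.instance Definition _ := Choice.on presAlg.

Definition pclass t : presAlg := \pi_({eq_quot acong_equivRel}) t.
Definition prepr (a : presAlg) : aexpr K (pgen P) :=
  repr (a : {eq_quot acong_equivRel}).

Lemma preprK a : pclass (prepr a) = a. Proof. exact: reprK. Qed.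

Lemma pclassP t u : pclass t = pclass u <-> acong t u.
Proof.
split=> [/eqmodP/asboolP//|tu]; by apply/eqmodP/asboolP.
Qed.

Lemma acong_prepr t : acong (prepr (pclass t)) t.
Proof. by apply/pclassP; rewrite preprK. Qed.

Let padd (a b : presAlg) := pclass (AAdd (prepr a) (prepr b)).
Let popp (a : presAlg) := pclass (AOpp (prepr a)).
Let pmul (a b : presAlg) := pclass (AMul (prepr a) (prepr b)).
Let pscale (c : K) (a : presAlg) := pclass (AScale c (prepr a)).

Let paddE t u : padd (pclass t) (pclass u) = pclass (AAdd t u).
Proof. by apply/pclassP; apply: ac_add; exact: acong_prepr. Qed.
Let poppE t : popp (pclass t) = pclass (AOpp t).
Proof. by apply/pclassP; apply: ac_opp; exact: acong_prepr. Qed.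
Let pmulE t u : pmul (pclass t) (pclass u) = pclass (AMul t u).
Proof. by apply/pclassP; apply: ac_mul; exact: acong_prepr. Qed.
Let pscaleE c t : pscale c (pclass t) = pclass (AScale c t).
Proof. by apply/pclassP; apply: ac_scale; exact: acong_prepr. Qed.
Let pind (Q : presAlg -> Prop) : (forall t, Q (pclass t)) -> forall a, Q a.
Proof. by move=> QP a; rewrite -(preprK a). Qed.

Let paddA : associative padd.
Proof.
elim/pind=> t; elim/pind=> u; elim/pind=> v.
by rewrite !paddE; apply/pclassP; exact: ac_addA.
Qed.
Let paddC : commutative padd.
Proof.
by elim/pind=> t; elim/pind=> u; rewrite !paddE; apply/pclassP; exact: ac_addC.
Qed.
Let padd0 : left_id (pclass AZero) padd.
Proof. by elim/pind=> t; rewrite paddE; apply/pclassP; exact: ac_add0. Qed.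
Let paddN : left_inverse (pclass AZero) popp padd.
Proof.
by elim/pind=> t; rewrite poppE paddE; apply/pclassP; exact: ac_addN.
Qed.
HB.instance Definition _ := GRing.isZmodule.Build presAlg paddA paddC padd0 paddN.

Let pmulA : associative pmul.
Proof.
elim/pind=> t; elim/pind=> u; elim/pind=> v.
by rewrite !pmulE; apply/pclassP; exact: ac_mulA.
Qed.
Let pmul1l : left_id (pclass AOne) pmul.
Proof. by elim/pind=> t; rewrite pmulE; apply/pclassP; exact: ac_mul1t. Qed.
Let pmul1r : right_id (pclass AOne) pmul.
Proof. by elim/pind=> t; rewrite pmulE; apply/pclassP; exact: ac_mult1. Qed.
Let pmulDl : left_distributive pmul padd.
Proof.
elim/pind=> t; elim/pind=> u; elim/pind=> v.
by rewrite !(paddE, pmulE); apply/pclassP; exact: ac_mulDl.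
Qed.
Let pmulDr : right_distributive pmul padd.
Proof.
elim/pind=> t; elim/pind=> u; elim/pind=> v.
by rewrite !(paddE, pmulE); apply/pclassP; exact: ac_mulDr.
Qed.
Let p1neq0 : pclass AOne != pclass AZero.
Proof.
apply/eqP => /pclassP /(aeval_acong (@paugP _ P)) /=.
by move/eqP; rewrite oner_eq0.
Qed.
HB.instance Definition _ := GRing.Zmodule_isNzRing.Build presAlg
  pmulA pmul1l pmul1r pmulDl pmulDr p1neq0.

Let pscaleA a b (x : presAlg) : pscale a (pscale b x) = pscale (a * b) x.
Proof.
by elim/pind: x => t; rewrite !pscaleE; apply/pclassP; exact: ac_scaleA.
Qed.
Let pscale1 : left_id 1 pscale.
Proof. by elim/pind=> t; rewrite pscaleE; apply/pclassP; exact: ac_scale1. Qed.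
Let pscaleDr c a b : pscale c (padd a b) = padd (pscale c a) (pscale c b).
Proof.
elim/pind: a => t; elim/pind: b => u.
by rewrite !(paddE, pscaleE); apply/pclassP; exact: ac_scaleDr.
Qed.
Let pscaleDl x a b : pscale (a + b) x = padd (pscale a x) (pscale b x).
Proof.
elim/pind: x => t.
by rewrite !(paddE, pscaleE); apply/pclassP; exact: ac_scaleDl.
Qed.
HB.instance Definition _ := GRing.Zmodule_isLmodule.Build K presAlg
  pscaleA pscale1 pscaleDr pscaleDl.

Let pscaleAl (c : K) (a b : presAlg) :
  pscale c (pmul a b) = pmul (pscale c a) b.
Proof.
elim/pind: a => t; elim/pind: b => u.
rewrite !(pmulE, pscaleE).
by apply/pclassP; exact: ac_scaleAl.
Qed.
HB.instance Definition _ := GRing.Lmodule_isLalgebra.Build K presAlg pscaleAl.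

Let pscaleAr (c : K) (a b : presAlg) :
  pscale c (pmul a b) = pmul a (pscale c b).
Proof.
elim/pind: a => t; elim/pind: b => u.
rewrite !(pmulE, pscaleE).
by apply/pclassP; exact: ac_scaleAr.
Qed.
HB.instance Definition _ := GRing.Lalgebra_isAlgebra.Build K presAlg pscaleAr.

Definition pgenerator (x : pgen P) : presAlg := pclass (AGen x).

(* The algebra morphism extending f, when f is compatible with the relations. *)
Definition plift (B : algType K) (f : pgen P -> B) (a : presAlg) : B :=
  aeval f (prepr a).

Definition pcounit : presAlg -> K^o := plift (@paug _ P).

Lemma pclassD t u : pclass (AAdd t u) = pclass t + pclass u.
Proof. by rewrite -paddE. Qed.
Lemma pclassM t u : pclass (AMul t u) = pclass t * pclass u.
Proof. by rewrite -pmulE. Qed.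
Lemma pclassZ c t : pclass (AScale c t) = c *: pclass t.
Proof. by rewrite -pscaleE. Qed.
Lemma pclassN t : pclass (AOpp t) = - pclass t.
Proof. by rewrite -poppE. Qed.
Lemma pclass1 : pclass AOne = 1. Proof. by []. Qed.
Lemma pclass0 : pclass AZero = 0. Proof. by []. Qed.

Lemma pcounit_pclass t : pcounit (pclass t) = aeval (@paug _ P) t.
Proof.
by apply: (aeval_acong (@paugP _ P)); exact: acong_prepr.
Qed.

Lemma pcounitD a b : pcounit (a + b) = pcounit a + pcounit b.
Proof.
by elim/pind: a => t; elim/pind: b => u; rewrite -pclassD !pcounit_pclass.
Qed.
Lemma pcounitM a b : pcounit (a * b) = pcounit a * pcounit b.
Proof.
by elim/pind: a => t; elim/pind: b => u; rewrite -pclassM !pcounit_pclass.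
Qed.
Lemma pcounitZ c a : pcounit (c *: a) = c *: pcounit a.
Proof. by elim/pind: a => t; rewrite -pclassZ !pcounit_pclass. Qed.
Lemma pcounit1 : pcounit 1 = 1.
Proof. by rewrite -pclass1 pcounit_pclass. Qed.

End PresentedAlgebra.

(* Evaluation in the opposite algebra. *)
Fixpoint aeval_rev (K : comNzRingType) (X : Type) (B : algType K) (f : X -> B)
    (t : aexpr K X) : B :=
  match t with
  | AGen x => f x
  | AZero => 0
  | AOne => 1
  | AOpp t => - aeval_rev f t
  | AScale c t => c *: aeval_rev f t
  | AAdd t u => aeval_rev f t + aeval_rev f u
  | AMul t u => aeval_rev f u * aeval_rev f t
  end.

Definition plift_rev (K : comNzRingType) (P : presentation K) (B : algType K)
    (f : pgen P -> B) (a : presAlg P) : B :=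
  aeval_rev f (prepr a).

(* The left module structure on V in which the generator x acts by f x. *)
Fixpoint aact (K : comNzRingType) (X : Type) (V : lmodType K) (f : X -> V -> V)
    (t : aexpr K X) (v : V) : V :=
  match t with
  | AGen x => f x v
  | AZero => 0
  | AOne => v
  | AOpp t => - aact f t v
  | AScale c t => c *: aact f t v
  | AAdd t u => aact f t v + aact f u v
  | AMul t u => aact f t (aact f u v)
  end.

Record lieAlgebra (K : fieldType) := LieAlgebra {
  lie_sort :> vectType K;
  bracket : lie_sort -> lie_sort -> lie_sort;
  bracket_linear : forall x, linear (bracket x);
  bracket_alt : forall x, bracket x x = 0;
  bracket_jacobi : forall x y z,
    bracket x (bracket y z) + bracket y (bracket z x)
      + bracket z (bracket x y) = 0
}.

Section LieAlgebras.
Context {K : fieldType} (g : lieAlgebra K).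

Definition lie_ideal (I : {vspace g}) : Prop :=
  forall x y : g, y \in I -> bracket x y \in I.

Definition lie_derived (I : {vspace g}) : {vspace g} :=
  <<[seq bracket x y | x <- vbasis I, y <- vbasis I]>>%VS.

Definition lie_solvable (I : {vspace g}) : Prop :=
  exists n, iter n lie_derived I = 0%VS.

Definition semisimple : Prop :=
  forall I : {vspace g}, lie_ideal I -> lie_solvable I -> I = 0%VS.

Inductive env_rel : aexpr K g -> aexpr K g -> Prop :=
| env_add x y : env_rel (AGen (x + y)) (AAdd (AGen x) (AGen y))
| env_scale c x : env_rel (AGen (c *: x)) (AScale c (AGen x))
| env_bracket x y : env_rel (AGen (bracket x y))
    (AAdd (AMul (AGen x) (AGen y)) (AOpp (AMul (AGen y) (AGen x)))).

Lemma env_augP t u : env_rel t u ->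
  aeval (fun _ : g => 0 : K^o) t = aeval (fun _ => 0) u.
Proof. by case=> *; rewrite /= ?mulr0 ?addr0 ?subr0 ?scaler0. Qed.

Definition env_presentation := Presentation env_augP.

Definition env : algType K := presAlg env_presentation.

Definition env_inj (x : g) : env := pgenerator (P := env_presentation) x.

Definition env_counit : env -> K^o := @pcounit _ env_presentation.

Definition env_antipode : env -> env :=
  plift_rev (P := env_presentation) (fun x => - env_inj x).

(* U(g)^{(x) n} is generated by the elements
   AGen (i, a) = 1 (x) ... (x) a (x) ... (x) 1, with a in position i. *)
Inductive tens_rel (n : nat) :
    aexpr K ('I_n * env) -> aexpr K ('I_n * env) -> Prop :=
| tens_add i a b :
    tens_rel (AGen (i, a + b)) (AAdd (AGen (i, a)) (AGen (i, b)))
| tens_scale i c a : tens_rel (AGen (i, c *: a)) (AScale c (AGen (i, a)))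
| tens_one i : tens_rel (AGen (i, 1)) AOne
| tens_mul i a b :
    tens_rel (AGen (i, a * b)) (AMul (AGen (i, a)) (AGen (i, b)))
| tens_comm i j a b : i != j ->
    tens_rel (AMul (AGen (i, a)) (AGen (j, b)))
             (AMul (AGen (j, b)) (AGen (i, a))).

Lemma tens_augP n t u : tens_rel (n := n) t u ->
  aeval (fun ia : 'I_n * env => env_counit ia.2) t =
  aeval (fun ia : 'I_n * env => env_counit ia.2) u.
Proof.
case=> * /=; rewrite /env_counit.
- exact: pcounitD.
- exact: pcounitZ.
- exact: pcounit1.
- exact: pcounitM.
- exact: (mulrC (_ : K)).
Qed.

Definition tens_presentation n := Presentation (@tens_augP n).

Definition tens (n : nat) : algType K := presAlg (tens_presentation n).

Definition slot n (i : 'I_n) (a : env) : tens n :=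
  pgenerator (P := tens_presentation n) (i, a).

(* The iterated comultiplication of U(g) with values in the positions listed
   in s: x |-> \sum_(i in s) x^(i) for x in g. The empty list gives the counit,
   a single position the corresponding embedding of U(g). *)
Definition cop (m : nat) (s : seq nat) : env -> tens m.+1 :=
  plift (P := env_presentation) (fun x => \sum_(i <- s) slot (inord i) (env_inj x)).

Definition Delta : env -> tens 2 := cop 1 [:: 0; 1]%N.

(* The algebra morphism from U(g)^{(x) n} that sends the k-th factor to the
   positions listed in the k-th list, through the iterated comultiplication. *)
Definition tens_cop (n m : nat) (s : seq (seq nat)) : tens n -> tens m.+1 :=
  plift (P := tens_presentation n)
    (fun ia => cop m (nth [::] s ia.1) ia.2).

(* s (x) ... (x) s *)
Definition tens_antipode (n : nat) : tens n -> tens n :=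
  plift_rev (P := tens_presentation n)
    (fun ia => slot ia.1 (env_antipode ia.2)).

(* x /\ y = x (x) y - y (x) x *)
Definition wedge2 (x y : g) : tens 2 :=
  slot ord0 (env_inj x) * slot ord_max (env_inj y)
  - slot ord0 (env_inj y) * slot ord_max (env_inj x).

Definition wedge3 (x y z : g) : tens 3 :=
  \sum_(s : 'S_3) (-1) ^+ s *:
    \prod_(i < 3) slot i (env_inj (tnth [tuple x; y; z] (s i))).

(* A sequence r of pairs stands for the element \sum_((x, y) <- r) x /\ y of
   the second exterior power of g. *)
Definition bivector (r : seq (g * g)) : tens 2 :=
  \sum_(p <- r) wedge2 p.1 p.2.

(* [[ \sum_p p.1 /\ p.2, \sum_q q.1 /\ q.2 ]] *)
Definition schouten (r r' : seq (g * g)) : tens 3 :=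
  \sum_(p <- r) \sum_(q <- r')
    (wedge3 (bracket p.1 q.1) p.2 q.2 - wedge3 (bracket p.1 q.2) p.2 q.1
     - wedge3 (bracket p.2 q.1) p.1 q.2 + wedge3 (bracket p.2 q.2) p.1 q.1).

Definition invariant3 (u : tens 3) : Prop :=
  forall b : env, cop 2 [:: 0; 1; 2]%N b * u = u * cop 2 [:: 0; 1; 2]%N b.

Definition classical_rmatrix (r : seq (g * g)) : Prop :=
  invariant3 (schouten r r).

End LieAlgebras.

Arguments env {K} g.
Arguments tens {K} g n.
Arguments cop {K g} m s.
Arguments tens_cop {K g} n m s.

Definition fps (A : Type) : Type := nat -> A.

HB.instance Definition _ (A : zmodType) :=
  GRing.Zmodule.copy (fps A) (nat -> A).
HB.instance Definition _ (K : pzRingType) (V : lmodType K) :=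
  GRing.Lmodule.copy (fps V) (nat -> V).

Definition fps_cst (A : nmodType) (a : A) : fps A :=
  fun n => if n == 0%N then a else 0.

Definition fps_map (A B : Type) (f : A -> B) (a : fps A) : fps B :=
  fun n => f (a n).

Section FpsRing.
Context (A : nzRingType).
Implicit Types a b c : fps A.

Definition fps_mul a b : fps A := fun n => \sum_(j < n.+1) a j * b (n - j)%N.

Let fps_mul_rev a b n : fps_mul a b n = \sum_(j < n.+1) a (n - j)%N * b j.
Proof.
rewrite /fps_mul (reindex_inj rev_ord_inj) /=.
by apply: eq_bigr => j _; rewrite (sub_ordK j).
Qed.

Let fps_mulA : associative fps_mul.
Proof.
move=> p q r; apply/funext => i; rewrite [LHS]/fps_mul fps_mul_rev.
pose coef3 j k := p j * (q (i - j - k)%N * r k).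
transitivity (\sum_(j < i.+1) \sum_(k < i.+1 | (k <= i - j)%N) coef3 j k).
  apply: eq_bigr => /= j _; rewrite fps_mul_rev big_distrr /=.
  by rewrite (big_ord_narrow_leq (leq_subr _ _)).
rewrite (exchange_big_dep predT) //=; apply: eq_bigr => k _.
transitivity (\sum_(j < i.+1 | (j <= i - k)%N) coef3 j k).
  apply: eq_bigl => j; rewrite -ltnS -(ltnS j) -!subSn ?leq_ord //.
  by rewrite -subn_gt0 -(subn_gt0 j) -!subnDA addnC.
rewrite (big_ord_narrow_leq (leq_subr _ _)) /fps_mul big_distrl /=.
by apply: eq_bigr => j _; rewrite /coef3 -!subnDA addnC mulrA.
Qed.

Let fps_mul1l : left_id (fps_cst 1) fps_mul.
Proof.
move=> a; apply/funext => n; rewrite /fps_mul big_ord_recl /= mul1r subn0.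
by rewrite big1 ?addr0 // => j _; rewrite mul0r.
Qed.
Let fps_mul1r : right_id (fps_cst 1) fps_mul.
Proof.
move=> a; apply/funext => n; rewrite fps_mul_rev big_ord_recl /= mulr1 subn0.
by rewrite big1 ?addr0 // => j _; rewrite mulr0.
Qed.
Let fps_mulDl : left_distributive fps_mul +%R.
Proof.
move=> a b c; apply/funext => n; rewrite /fps_mul.
rewrite [RHS](_ : _ = fps_mul a c n + fps_mul b c n) // -big_split /=.
by apply: eq_bigr => j _; rewrite -mulrDl.
Qed.
Let fps_mulDr : right_distributive fps_mul +%R.
Proof.
move=> a b c; apply/funext => n; rewrite /fps_mul.
rewrite [RHS](_ : _ = fps_mul a b n + fps_mul a c n) // -big_split /=.
by apply: eq_bigr => j _; rewrite -mulrDr.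
Qed.
Let fps_1neq0 : fps_cst (1 : A) != 0.
Proof.
by apply/eqP => /(congr1 (fun a : fps A => a 0%N)) /eqP; rewrite /= oner_eq0.
Qed.
HB.instance Definition _ := GRing.Zmodule_isNzRing.Build (fps A)
  fps_mulA fps_mul1l fps_mul1r fps_mulDl fps_mulDr fps_1neq0.

Let invertible a b := b * a = 1 /\ a * b = 1.

Definition fps_unit : pred (fps A) := fun a => `[< exists b, invertible a b >].

Definition fps_inv a : fps A :=
  match pselect (exists b, invertible a b) with
  | left e => projT1 (cid e)
  | right _ => a
  end.

Let fps_invP a : a \in fps_unit -> invertible a (fps_inv a).
Proof.
move=> /asboolP ua; rewrite /fps_inv; case: pselect => // e.
exact: (projT2 (cid e)).
Qed.
Let fps_mulVr : {in fps_unit, left_inverse 1 fps_inv *%R}.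
Proof. by move=> a /fps_invP[]. Qed.
Let fps_mulrV : {in fps_unit, right_inverse 1 fps_inv *%R}.
Proof. by move=> a /fps_invP[]. Qed.
Let fps_unitP a b : b * a = 1 /\ a * b = 1 -> fps_unit a.
Proof. by move=> ab; apply/asboolP; exists b. Qed.
Let fps_inv_out : {in [predC fps_unit], fps_inv =1 id}.
Proof.
move=> a; rewrite inE => /asboolPn na; rewrite /fps_inv.
by case: pselect => // e; case: na.
Qed.
HB.instance Definition _ := GRing.NzRing_hasMulInverse.Build (fps A)
  fps_mulVr fps_mulrV fps_unitP fps_inv_out.

End FpsRing.

Inductive kind := Smooth | Analytic | Algebraic.

Section LocalModels.
Context {R : realType}.
Local Notation C := R[i].

Inductive poly_fun (N : nat) : ('rV[C^o]_N -> C) -> Prop :=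
| poly_cst c : poly_fun (fun _ => c)
| poly_coord i : poly_fun (fun z => z 0 i)
| poly_add p q : poly_fun p -> poly_fun q -> poly_fun (fun z => p z + q z)
| poly_mul p q : poly_fun p -> poly_fun q -> poly_fun (fun z => p z * q z).

Definition of_real_coords (N : nat) (u : 'rV[R]_(N + N)) : 'rV[C^o]_N :=
  \row_i (u 0 (lshift N i) +i* u 0 (rshift N i))%C.

Fixpoint Ck_on (n k : nat) (O : set 'rV[R]_n) (h : 'rV[R]_n -> R) : Prop :=
  (forall u, O u -> {for u, continuous h}) /\
  if k is k'.+1 then
    forall v, (forall u, O u -> derivable h u v) /\ Ck_on k' O ('D_v h)
  else True.

(* H is C^oo near p as a function of the real and imaginary parts. *)
Definition smooth_at (N : nat) (H : 'rV[C^o]_N -> C) (p : 'rV[C^o]_N) : Prop :=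
  exists O : set 'rV[R]_(N + N),
    [/\ open O, (exists2 u, O u & of_real_coords u = p) &
      forall k, Ck_on k O (fun u => complex.Re (H (of_real_coords u))) /\
                Ck_on k O (fun u => complex.Im (H (of_real_coords u)))].

Definition holomorphic_at (N : nat) (H : 'rV[C^o]_N -> C) (p : 'rV[C^o]_N) : Prop :=
  \forall q \near p, differentiable (H : 'rV[C^o]_N -> C^o) q.

Definition rational_at (N : nat) (H : 'rV[C^o]_N -> C) (p : 'rV[C^o]_N) : Prop :=
  exists a b, [/\ poly_fun a, poly_fun b, b p != 0 &
    forall q, b q != 0 -> H q = a q / b q].

Definition model_reg (k : kind) (N : nat) : ('rV[C^o]_N -> C) -> 'rV[C^o]_N -> Prop :=
  match k with
  | Smooth => @smooth_at N
  | Analytic => @holomorphic_at N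
  | Algebraic => @rational_at N
  end.

(* Neighbourhoods in C^N, for the Zariski topology in the algebraic case. *)
Definition model_nbhs (k : kind) (N : nat) (p : 'rV[C^o]_N) : set_system 'rV[C^o]_N :=
  match k with
  | Algebraic => [set A | exists b, [/\ poly_fun b, b p != 0 &
                                       forall q, b q != 0 -> A q]]
  | _ => nbhs p
  end.

(* The local models of dimension d: open subsets of R^d, regarded as a subset
   of C^d; open subsets of C^d; and smooth affine varieties
   { f_1 = ... = f_m = 0, b <> 0 } in C^(d + m) whose Jacobian matrix has rank
   m everywhere. *)
Definition local_model (k : kind) (d N : nat) (V : set 'rV[C^o]_N) : Prop :=
  match k with
  | Smooth => N = d /\ exists2 O : set 'rV[C^o]_N, open O &
      V = O `&` [set z | forall i, complex.Im (z 0 i) = 0]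
  | Analytic => N = d /\ open V
  | Algebraic => exists m (f : 'I_m -> 'rV[C^o]_N -> C) (b : 'rV[C^o]_N -> C),
      [/\ N = (d + m)%N, forall j, poly_fun (f j), poly_fun b,
          V = [set z | (forall j, f j z = 0) /\ b z != 0] &
          forall z, V z -> \rank (\matrix_(i < N, j < m)
            ('D_(delta_mx 0 i) (f j : 'rV[C^o]_N -> C^o) z : C)) = m]
  end.

End LocalModels.

(* A topological space with a sheaf of C-valued functions, given by its germs:
   reg x f means that f is a regular function near x; the values of f far
   from x are irrelevant. *)
Record funSpace (R : realType) := FunSpace {
  fs_space :> topologicalType;
  reg : fs_space -> (fs_space -> R[i]) -> Prop;
  reg_local : forall x f f', (\forall y \near x, f y = f' y) ->
    reg x f -> reg x f';
  reg_near : forall x f, reg x f -> \forall y \near x, reg y f;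
  reg_cst : forall x c, reg x (fun _ => c);
  reg_add : forall x f f', reg x f -> reg x f' -> reg x (fun y => f y + f' y);
  reg_mul : forall x f f', reg x f -> reg x f' -> reg x (fun y => f y * f' y)
}.

Section Manifolds.
Context {R : realType}.
Local Notation C := R[i].
Implicit Types X Y Z : funSpace R.

(* s identifies a neighbourhood U of x with a local model of dimension d. *)
Definition has_chart (k : kind) (d : nat) X (x : X) : Prop :=
  exists N (s : X -> 'rV[C^o]_N) (U : set X),
    [/\ open U /\ U x,
        {in U &, injective s} /\ local_model k d (s @` U),
        forall y, U y -> forall W, nbhs y W <->
          exists2 O, model_nbhs k (s y) O & forall y', U y' -> O (s y') -> W y' &
        forall y, U y -> forall f, reg y f <->
          exists2 H, model_reg k H (s y) &
            exists2 O, model_nbhs k (s y) O &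
              forall y', U y' -> O (s y') -> f y' = H (s y')].

(* F is regular at (x, y) for the product structure: near (x, y), it is a
   function of kind k of finitely many regular functions on X and on Y. *)
Definition reg_prod (k : kind) X Y (x : X) (y : Y) (F : X -> Y -> C) : Prop :=
  exists p q (s : X -> 'rV[C^o]_p) (t : Y -> 'rV[C^o]_q) H,
    [/\ forall i, reg x (fun x' => s x' 0 i),
        forall i, reg y (fun y' => t y' 0 i),
        model_reg k H (row_mx (s x) (t y)) &
        exists U V O, [/\ nbhs x U, nbhs y V,
          model_nbhs k (row_mx (s x) (t y)) O &
          forall x' y', U x' -> V y' -> O (row_mx (s x') (t y')) ->
            F x' y' = H (row_mx (s x') (t y'))]].

(* Since f is arbitrary away from phi x y, this also forces the continuity of
   phi. *)
Definition regular_map2 (k : kind) X Y Z (phi : X -> Y -> Z) : Prop :=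
  forall x y f, reg (phi x y) f -> reg_prod k x y (fun x' y' => f (phi x' y')).

Definition separated X : Prop :=
  forall x y : X, x <> y -> exists F,
    [/\ reg_prod Algebraic x y F, F x y != 0 & forall z, F z z = 0].

Definition manifold (k : kind) X : Prop :=
  match k with
  | Algebraic => compact [set: X] /\ separated X
  | _ => hausdorff_space X /\ second_countable (T := X)
  end /\
  exists d, forall x : X, has_chart k d x.

End Manifolds.

Record opens (X : topologicalType) := Opens {
  opens_set :> X -> Prop;
  opensP : open (opens_set : set X)
}.

Section Sections.
Context {R : realType} (X : funSpace R) (U : opens X).
Local Notation C := R[i].

(* A section over U is represented by its extension by zero to X. *)
Definition is_section : {pred X -> C} := fun f =>
  `[< (forall x, U x -> reg x f) /\ (forall x, ~ U x -> f x = 0) >].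

Record sect := Sect { sect_fun :> X -> C; sect_prop : sect_fun \in is_section }.
HB.instance Definition _ := [isSub for sect_fun].
HB.instance Definition _ := [Choice of sect by <:].

Let is_sectionP f : reflect
  ((forall x, U x -> reg x f) /\ (forall x, ~ U x -> f x = 0)) (f \in is_section).
Proof. exact: asboolP. Qed.

Let is_section_zmod : zmod_closed is_section.
Proof.
split=> [|f f'].
  by apply/is_sectionP; split=> // x _; exact: reg_cst.
move=> /is_sectionP[rf zf] /is_sectionP[rf' zf']; apply/is_sectionP; split=> x Ux.
  have -> : f - f' = (fun y => f y + -1 * f' y).
    by apply/funext => y; rewrite mulN1r.
  by apply: reg_add; [exact: rf | apply: reg_mul; [exact: reg_cst | exact: rf']].
by rewrite [LHS](_ : _ = f x - f' x) // zf // zf' // subr0.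
Qed.
HB.instance Definition _ := GRing.isZmodClosed.Build (X -> C) is_section
  is_section_zmod.
Let is_section_scale : GRing.scaler_closed is_section.
Proof.
move=> c f; move=> /is_sectionP[rf zf]; apply/is_sectionP; split=> x Ux.
  by apply: reg_mul; [exact: reg_cst | exact: rf].
by rewrite [LHS](_ : _ = c * f x) // zf // mulr0.
Qed.
HB.instance Definition _ := GRing.isScaleClosed.Build C (X -> C) is_section
  is_section_scale.
HB.instance Definition _ := [SubChoice_isSubLmodule of sect by <:].

Lemma sect_reg (f : sect) x : U x -> reg x f.
Proof. by case: f => f /= /is_sectionP[rf _]; exact: rf. Qed.

Lemma sect_out (f : sect) x : ~ U x -> f x = 0.
Proof. by case: f => f /= /is_sectionP[_ zf]; exact: zf. Qed.

Lemma sect_ext (f f' : sect) : (forall x, U x -> f x = f' x) -> f = f'.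
Proof.
move=> ff'; apply: val_inj; apply/funext => x /=.
by have [/ff'//|nUx] := pselect (U x); rewrite !sect_out.
Qed.

Let sect_mul_subproof (f f' : sect) : (fun x => f x * f' x) \in is_section.
Proof.
apply/is_sectionP; split=> x Ux; last by rewrite sect_out ?mul0r.
by apply: reg_mul; exact: sect_reg.
Qed.
Let sect_mul (f f' : sect) : sect := Sect (sect_mul_subproof f f').

Let sect_one_subproof : (fun x => if `[< U x >] then 1 else 0) \in is_section.
Proof.
apply/is_sectionP; split=> x Ux; last by rewrite asboolF.
apply: reg_local (reg_cst x 1).
have : nbhs x (opens_set U) by apply: open_nbhs_nbhs; split=> //; exact: opensP.
by apply: filterS => y Uy; rewrite asboolT.
Qed.
Let sect_one : sect := Sect sect_one_subproof.

Let sect_mulA : associative sect_mul.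
Proof. by move=> f f' f''; apply: sect_ext => x _ /=; rewrite mulrA. Qed.
Let sect_mulC : commutative sect_mul.
Proof. by move=> f f'; apply: sect_ext => x _ /=; rewrite mulrC. Qed.
Let sect_mul1 : left_id sect_one sect_mul.
Proof. by move=> f; apply: sect_ext => x Ux /=; rewrite asboolT// mul1r. Qed.
Let sect_mulD : left_distributive sect_mul +%R.
Proof.
move=> f f' f''; apply: sect_ext => x _.
rewrite [LHS](_ : _ = (f x + f' x) * f'' x) // mulrDl.
by [].
Qed.
HB.instance Definition _ := GRing.Zmodule_isComPzRing.Build sect
  sect_mulA sect_mulC sect_mul1 sect_mulD.

End Sections.

Section SheafOperators.
Context {R : realType} (X : funSpace R).
Local Notation C := R[i].
Implicit Types U V W : opens X.

Definition agree_on (V : set X) (f f' : X -> C) : Prop :=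
  forall x, V x -> f x = f' x.

Definition operator := forall U, sect U -> sect U.
Definition bioperator := forall U, sect U -> sect U -> sect U.

Record vector_field (D : operator) : Prop := VectorField {
  vf_linear : forall U, linear (@D U);
  vf_leibniz : forall U (f f' : sect U), D U (f * f') = D U f * f' + f * D U f';
  vf_restrict : forall U V, opens_set V `<=` opens_set U -> forall (f : sect U) (f' : sect V),
    agree_on V f f' -> agree_on V (D U f) (D V f')
}.

Record sheaf_bilinear (B : bioperator) : Prop := SheafBilinear {
  sb_linearl : forall U (y : sect U), linear (fun x => B U x y);
  sb_linearr : forall U (x : sect U), linear (B U x);
  sb_restrict : forall U V, opens_set V `<=` opens_set U ->
    forall (x y : sect U) (x' y' : sect V), agree_on V x x' -> agree_on V y y' ->
      agree_on V (B U x y) (B V x' y')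
}.

(* Grothendieck's definition of the differential operators of order at most n;
   bidifferential operators are those that are, locally on X and uniformly, of
   finite order in each argument. *)
Fixpoint diff_op_le U (n : nat) (E : sect U -> sect U) : Prop :=
  forall a : sect U, let ad x := E (a * x) - a * E x in
    if n is n'.+1 then diff_op_le n' ad else forall x, ad x = 0.

Definition bidifferential (B : bioperator) : Prop :=
  sheaf_bilinear B /\
  forall x : X, exists n (V : opens X), V x /\
    forall W, opens_set W `<=` opens_set V -> forall f : sect W,
      diff_op_le n (B W f) /\ diff_op_le n (fun f' => B W f' f).

Definition vanishes_on_constants (B : bioperator) : Prop :=
  forall U (c : C) (f : sect U), B U (c *: (1 : sect U)) f = 0 /\ B U f (c *: (1 : sect U)) = 0.

End SheafOperators.

Record lieGroup (R : realType) := LieGroup {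
  lg_space :> funSpace R;
  lg_manifold : manifold Analytic lg_space;
  lg_mul : lg_space -> lg_space -> lg_space;
  lg_one : lg_space;
  lg_inv : lg_space -> lg_space;
  lg_mulA : associative lg_mul;
  lg_mul1 : left_id lg_one lg_mul;
  lg_mulV : left_inverse lg_one lg_inv lg_mul;
  lg_mul_regular : regular_map2 Analytic lg_mul;
  lg_inv_regular : forall a f, reg (lg_inv a) f -> reg a (f \o lg_inv)
}.

Section LieGroups.
Context {R : realType} (G : lieGroup R).
Local Notation C := R[i].

Definition left_invariant (D : operator G) : Prop :=
  forall (a : G) (U V : opens G), (forall b, V b <-> U (lg_mul a b)) ->
    forall (f : sect U) (f' : sect V),
      agree_on V f' (fun b => f (lg_mul a b)) ->
      agree_on V (D V f') (fun b => D U f (lg_mul a b)).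

(* lam identifies g with the Lie algebra of left invariant holomorphic vector
   fields on G. *)
Record lie_algebra_of (g : lieAlgebra C) (lam : g -> operator G) : Prop :=
  LieAlgebraOf {
    la_field : forall x, vector_field (lam x) /\ left_invariant (lam x);
    la_linear : forall U (f : sect U), linear (fun x => lam x U f);
    la_bracket : forall x y U (f : sect U),
      lam (bracket x y) U f = lam x U (lam y U f) - lam y U (lam x U f);
    la_bij : forall D, vector_field D -> left_invariant D ->
      exists! x, lam x = D
  }.

(* A holomorphic curve in G, defined near 0, through the unit element. *)
Definition holomorphic_curve (gam : C -> G) : Prop :=
  gam 0 = lg_one G /\
  \forall z \near (0 : C^o),
    {for z, continuous (gam : C^o -> G)} /\
    forall f, reg (gam z) f -> derivable (f \o gam : C^o -> C^o) z 1.

Definition has_velocity (gam : C -> G) (D : operator G) : Prop :=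
  forall (U : opens G) (f : sect U), U (lg_one G) ->
    'D_(1 : C^o) (f \o gam : C^o -> C^o) (0 : C^o) = D U f (lg_one G).

(* Algebraic group structure on G: X is an algebraic group, and the bijection e
   identifies G with the complex Lie group underlying X. *)
Record algebraic_structure (X : funSpace R) (e : G -> X) (e' : X -> G) : Prop :=
  AlgebraicStructure {
    as_manifold : manifold Algebraic X;
    as_cancel : cancel e e' /\ cancel e' e;
    as_mul : regular_map2 Algebraic (fun x y => e (lg_mul (e' x) (e' y)));
    as_inv : forall x f, reg (e (lg_inv (e' x))) f ->
      reg x (fun y => f (e (lg_inv (e' y))));
    as_continuous : continuous e;
    as_reg : forall (a : G) f, reg a f <->
      exists N (s : X -> 'rV[C^o]_N) H,
        [/\ forall i, reg (e a) (fun x => s x 0 i), holomorphic_at H (s (e a)) &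
            \forall b \near a, f b = H (s (e b))]
  }.

Definition regular_action (k : kind) (M : funSpace R) (act : G -> M -> M) : Prop :=
  match k with
  | Algebraic => exists (X : funSpace R) (e : G -> X) (e' : X -> G),
      algebraic_structure e e' /\
      regular_map2 Algebraic (fun x m => act (e' x) m)
  | _ => regular_map2 k act
  end.

(* d/dz = (d/ds - i d/dt) / 2 at 0, where z = s + i t. *)
Definition wirtinger (phi : C -> C) : C :=
  let d (h : R -> C) : C :=
    (derive1 (fun t => complex.Re (h t)) 0
      +i* derive1 (fun t => complex.Im (h t)) 0)%C in
  (d (fun s => phi (s +i* 0)%C) - (0 +i* 1)%C * d (fun t => phi (0 +i* t)%C)) / 2.

End LieGroups.

(* The action of g on functions is the differential of the action of G, that
   is x . f = d/dz f(exp(- z x) m) at z = 0, the derivative being the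
   holomorphic one: for smooth functions, this selects the C-linear part of
   the action of g. *)
Record gManifold (R : realType) (k : kind) (G : lieGroup R)
    (g : lieAlgebra R[i]) (lam : g -> operator G) := GManifold {
  gm_space :> funSpace R;
  gm_manifold : manifold k gm_space;
  gm_act : G -> gm_space -> gm_space;
  gm_act1 : forall m, gm_act (lg_one G) m = m;
  gm_actM : forall a b m, gm_act (lg_mul a b) m = gm_act a (gm_act b m);
  gm_act_regular : regular_action k gm_act;
  gm_rho : g -> operator gm_space;
  gm_rho_field : forall x, vector_field (gm_rho x);
  gm_rho_linear : forall U (f : sect U), linear (fun x => gm_rho x f);
  gm_rho_bracket : forall x y U (f : sect U),
    gm_rho (bracket x y) f
    = gm_rho x (gm_rho y f) - gm_rho y (gm_rho x f);
  gm_rhoE : forall x gam, holomorphic_curve gam -> has_velocity gam (lam x) ->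
    forall (U : opens gm_space) (f : sect U) m, U m ->
      gm_rho x f m = - wirtinger (fun z => f (gm_act (gam z) m))
}.

Arguments gm_rho {R k G g lam} M x U f : rename.

Record quantumGroup (K : fieldType) (g : lieAlgebra K) (r : seq (g * g)) :=
  QuantumGroup {
    qF : fps (tens g 2);
    qPhi : fps (tens g 3);
    qF0 : qF 0%N = 1;
    qF1 : qF 1%N = 2^-1 *: bivector r;
    qF_counitl : fps_map (tens_cop 2 0 [:: [::]; [:: 0]]%N) qF = 1;
    qF_counitr : fps_map (tens_cop 2 0 [:: [:: 0]; [::]]%N) qF = 1;
    qF_Phi :
      fps_map (tens_cop 2 2 [:: [:: 0]; [:: 1]]%N) qF
        * fps_map (tens_cop 2 2 [:: [:: 0; 1]; [:: 2]]%N) qF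
      = fps_map (tens_cop 2 2 [:: [:: 1]; [:: 2]]%N) qF
        * fps_map (tens_cop 2 2 [:: [:: 0]; [:: 1; 2]]%N) qF * qPhi;
    qPhi_invariant : forall n, invariant3 (qPhi n);
    qPhi0 : qPhi 0%N = 1;
    qPhi1 : qPhi 1%N = 0;
    qPhi2 : exists2 c : K, c != 0 & qPhi 2%N = c *: schouten r r;
    qPhi_pentagon :
      fps_map (tens_cop 3 3 [:: [:: 0]; [:: 1]; [:: 2; 3]]%N) qPhi
        * fps_map (tens_cop 3 3 [:: [:: 0; 1]; [:: 2]; [:: 3]]%N) qPhi
      = fps_map (tens_cop 3 3 [:: [:: 1]; [:: 2]; [:: 3]]%N) qPhi
        * fps_map (tens_cop 3 3 [:: [:: 0]; [:: 1; 2]; [:: 3]]%N) qPhi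
        * fps_map (tens_cop 3 3 [:: [:: 0]; [:: 1]; [:: 2]]%N) qPhi;
    qPhi_antipode : qPhi * fps_map (@tens_antipode _ g 3) qPhi = 1
  }.

Definition qDelta (K : fieldType) (g : lieAlgebra K) (r : seq (g * g))
    (Q : quantumGroup r) (b : env g) : fps (tens g 2) :=
  qF Q * fps_cst (Delta b) * (qF Q)^-1.

(* T(u (x_1 (x) ... (x) x_n)), for u in U(g)^{(x) n} and a multilinear map T. *)
Section TensorAction.
Context {K : fieldType} {g : lieAlgebra K} {A W : lmodType K}.
Context (rho : g -> A -> A).

Definition env_act (b : env g) (x : A) : A :=
  aact rho (prepr (P := env_presentation g) b) x.

Fixpoint precomp (n : nat) (t : aexpr K ('I_n * env g)) (T : ('I_n -> A) -> W)
    (x : 'I_n -> A) : W :=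
  match t with
  | AGen ib => T (fun j => if j == ib.1 then env_act ib.2 (x j) else x j)
  | AZero => 0
  | AOne => T x
  | AOpp t => - precomp t T x
  | AScale c t => c *: precomp t T x
  | AAdd t u => precomp t T x + precomp u T x
  | AMul t u => precomp u (precomp t T) x
  end.

Definition tens_precomp (n : nat) (u : tens g n) (T : ('I_n -> A) -> W) :
    ('I_n -> A) -> W :=
  precomp (prepr (P := tens_presentation g n) u) T.

End TensorAction.

(* The same for u in U(g)^{(x) n}[[h]] and T with values in W[[h]]. *)
Definition fps_precomp (K : fieldType) (g : lieAlgebra K) (A W : lmodType K)
    (rho : g -> A -> A) (n : nat) (u : fps (tens g n)) (T : ('I_n -> A) -> fps W) :
    ('I_n -> A) -> fps W :=
  fun x k => \sum_(j < k.+1) tens_precomp rho (u j) T x (k - j)%N.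

Section Quantizations.
Context {R : realType} {k : kind} {G : lieGroup R} {g : lieAlgebra R[i]}.
Context {lam : g -> operator G} (M : gManifold k lam).
Context {r : seq (g * g)} (Q : quantumGroup r).

(* A C[[h]]-bilinear multiplication on A[[h]] is the sum of h^n mu_n, for
   C-bilinear maps mu_n on A. *)
Definition hmult := nat -> bioperator M.
Implicit Types mu m : hmult.

Definition is_hmult mu : Prop := forall n, sheaf_bilinear (mu n).

(* mu(x (x) y) in A[[h]], for x and y in A *)
Definition hval mu (U : opens M) (x y : sect U) : fps (sect U) :=
  fun n => mu n U x y.

(* mu(a (x) b) in A[[h]], for a and b in A[[h]] *)
Definition hext mu (U : opens M) (a b : fps (sect U)) : fps (sect U) :=
  fun n => \sum_(i < n.+1) \sum_(j < (n - i).+1) mu (n - i - j)%N U (a i) (b j).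

(* mu(u (x (x) y)), for u in U(g)^{(x) 2}[[h]] and x and y in A *)
Definition hval_tens mu (u : fps (tens g 2)) (U : opens M) (x y : sect U) :
    fps (sect U) :=
  fps_precomp (fun z => gm_rho M z U) u
    (fun v => hval mu (v ord0) (v ord_max)) (tnth [tuple x; y]).

Definition associative_mult m : Prop :=
  forall (U : opens M) (x y z : sect U),
    hext m (fps_cst x) (hval m y z) = hext m (hval m x y) (fps_cst z).

Definition Phi_associative mu : Prop :=
  forall (U : opens M) (x y z : sect U),
    fps_precomp (fun w => gm_rho M w U) (qPhi Q)
      (fun v => hext mu (fps_cst (v ord0)) (hval mu (v (inord 1)) (v ord_max)))
      (tnth [tuple x; y; z])
    = hext mu (hval mu x y) (fps_cst z).

Definition hact (U : opens M) (b : env g) (a : fps (sect U)) : fps (sect U) :=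
  fps_map (env_act (fun z => gm_rho M z U) b) a.

Definition U_invariant mu : Prop :=
  forall b (U : opens M) (x y : sect U),
    hact b (hval mu x y) = hval_tens mu (fps_cst (Delta b)) x y.

Definition Uh_invariant m : Prop :=
  forall b (U : opens M) (x y : sect U),
    hact b (hval m x y) = hval_tens m (qDelta Q b) x y.

Definition is_deformation mu : Prop :=
  (forall (U : opens M) (x y : sect U), mu 0%N U x y = x * y) /\
  forall n, (0 < n)%N -> bidifferential (mu n) /\ vanishes_on_constants (mu n).

Definition quantization m : Prop :=
  [/\ is_hmult m, associative_mult m & is_deformation m].

Definition Phi_quantization mu : Prop :=
  [/\ is_hmult mu, Phi_associative mu & is_deformation mu].

(* mu F_h^{-1} *)
Definition twist mu : hmult :=
  fun n U x y => hval_tens mu (qF Q)^-1 x y n.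

End Quantizations.

(* Main.v *)
Require Import Defs.
From mathcomp Require Import all_boot all_order all_algebra.
From mathcomp Require Import all_classical all_reals all_analysis.
From mathcomp Require Import complex.

(** Write [T . u] for the precomposition of a multilinear map [T] with the
    action of an element [u] of a tensor power of [U(g)] on its arguments, so
    that [T . (u * v) = (T . u) . v].  If [m = mu . F^-1] then
    [mu = m . F], and the claims compare [m] and [mu] through this relation,
    which is symmetric because [F], with constant term 1, is invertible.

    Invariance.  The action of [b] on values commutes with precomposition, so
    [b mu = mu . Delta b] turns into [b m = m . (F * Delta b * F^-1)] and
    conversely ([twist_Delta]).

    Associativity.  Let [mul], [mur] be the trilinear maps
    [mu (mu (x, y), z)] and [mu (x, mu (y, z))], and [ml], [mr] those of [m].
    Replacing the inner [m] of [ml] by [mu] amounts to precomposing with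
    [F (x) 1]; replacing then the outer [m] by [mu] amounts to precomposing with
    [(Delta (x) id) F], since [F] acts on the value of an invariant
    multiplication through [Delta].  Thus
    [mul = ml . ((F (x) 1) * (Delta (x) id) F)] and, in the same way,
    [mur = mr . ((1 (x) F) * (id (x) Delta) F)] ([assocl_twist],
    [assocr_twist]).  The defining equation of [Phi] says that the second
    factor times [Phi] is the first one, call it [Z]; hence
    [mur . Phi = mr . Z] and [mul = ml . Z].  As [Z] has constant term 1, it is
    invertible, and [mur . Phi = mul] is equivalent to [mr = ml]
    ([twist_associative]).  Both replacements, and the counit computation
    below, are instances of one statement about iterated comultiplications,
    [tens_cop_precomp].

    Deformations.  The constant term of [F] is 1, so [m] and [mu] have the same
    constant term.  A vector field kills constants, so [F] acts on
    [m (c, f)], for [c] constant, through [(eps (x) id) F = 1]: the two families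
    agree as soon as one argument is constant ([twist_constl],
    [twist_constr]), and one vanishes on constants when the other does.
    Finally the coefficients of [F] and [F^-1] act by differential operators,
    and precomposing with these keeps bidifferential operators bidifferential
    ([twist_stable_fps]). *)

Set Implicit Arguments.
Unset Strict Implicit.
Unset Printing Implicit Defensive.

Import GRing.Theory.

Local Open Scope classical_set_scope.
Local Open Scope ring_scope.

(** * Formal power series *)

Section TriangularSums.
Context {V : nmodType}.

Lemma triangular_exchange (n : nat) (f : nat -> nat -> V) :
  \sum_(i < n.+1) \sum_(j < (n - i).+1) f i j =
  \sum_(j < n.+1) \sum_(i < (n - j).+1) f i j.
Proof.
have wide (h : nat -> nat -> V) :
  \sum_(i < n.+1) \sum_(j < (n - i).+1) h i j =
  \sum_(i < n.+1) \sum_(j < n.+1 | (i + j <= n)%N) h i j.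
  apply: eq_bigr => i _.
  under [RHS]eq_bigl => j do rewrite -leq_subRL ?leq_ord //.
  by rewrite (big_ord_narrow_leq (leq_subr _ _)).
rewrite (wide f) (wide (fun j i => f i j)) (exchange_big_dep predT) //=.
by apply: eq_bigr => j _; apply: eq_bigl => i; rewrite addnC.
Qed.

Lemma triangular_diagonal (n : nat) (f : nat -> nat -> nat -> V) :
  \sum_(i < n.+1) \sum_(j < i.+1) f j (i - j)%N (n - i)%N =
  \sum_(j < n.+1) \sum_(i < (n - j).+1) f j i (n - j - i)%N.
Proof.
rewrite (reindex_inj rev_ord_inj) /=.
under eq_bigr => i _.
  have le_in : (i <= n)%N by rewrite -ltnS.
  rewrite subSS; under eq_bigr => j _ do rewrite (subKn le_in) subnAC.
  over.
rewrite (triangular_exchange n (fun i j => f j (n - j - i)%N i)).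
apply: eq_bigr => j _; rewrite (reindex_inj rev_ord_inj) /=.
by apply: eq_bigr => i _; rewrite subSS subKn // -ltnS.
Qed.

End TriangularSums.

Section FpsUnits.
Context {A : nzRingType}.
Implicit Types a x : fps A.

Lemma fps_coefM a b n : (a * b) n = \sum_(j < n.+1) a j * b (n - j)%N.
Proof. by []. Qed.

Lemma fps_coefD (V : zmodType) (a b : fps V) n : (a + b) n = a n + b n.
Proof. by []. Qed.

Lemma fps_coefB (V : zmodType) (a b : fps V) n : (a - b) n = a n - b n.
Proof. by []. Qed.

Lemma fps_coef_sum (V : zmodType) I (s : seq I) (F : I -> fps V) n :
  (\sum_(i <- s) F i) n = \sum_(i <- s) F i n.
Proof.
by elim: s => [|i s IHs]; rewrite ?big_nil // !big_cons fps_coefD IHs.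
Qed.

Lemma fps_coefX_small x k n : x 0%N = 0 -> (n < k)%N -> (x ^+ k) n = 0.
Proof.
move=> x0; elim: k n => // k IHk n lt_nk.
rewrite exprS fps_coefM big1 // => -[[|j] lt_jn] _ /=; first by rewrite x0 mul0r.
rewrite IHk ?mulr0 //; case: n lt_nk lt_jn => // n lt_nk _.
by rewrite ltnS in lt_nk; rewrite subSS (leq_ltn_trans (leq_subr _ _)).
Qed.

(** If [a = 1 - x] and [x] has no constant term, then [x ^+ k] only contributes
    from degree [k] on, so the geometric series converges degree by degree. *)
Lemma fps_unit_coef0 a : a 0%N = 1 -> a \is a GRing.unit.
Proof.
move=> a0; pose x := 1 - a.
have x0 : x 0%N = 0 by rewrite /x fps_coefB a0; apply: subrr.
pose geom N := \sum_(k < N) x ^+ k.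
have geom_coef N n : (n < N)%N -> geom N n = geom n.+1 n.
  move=> /subnKC <-; rewrite /geom big_split_ord /= fps_coefD.
  rewrite [X in _ + X]fps_coef_sum.
  rewrite [X in _ + X]big1 ?addr0 // => k _.
  by rewrite fps_coefX_small // ltnS leq_addr.
have ax : a = 1 - x by rewrite opprB addrC subrK.
have geomMl N : a * geom N = 1 - x ^+ N.
  by rewrite ax /geom -opprB mulNr -subrX1 opprB.
have geomMr N : geom N * a = 1 - x ^+ N.
  rewrite -geomMl; apply: commr_sym; apply: commr_sum => k _; apply: commrX.
  by apply: commrB => //; apply: commr1.
apply/unitrP; exists (fun n => geom n.+1 n); split; apply/funext => n.
- transitivity ((geom n.+1 * a) n); last first.
    by rewrite geomMr fps_coefB fps_coefX_small // subr0.
  rewrite !fps_coefM; apply: eq_bigr => j _; congr (_ * _).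
  by rewrite (geom_coef n.+1) // ltn_ord.
- transitivity ((a * geom n.+1) n); last first.
    by rewrite geomMl fps_coefB fps_coefX_small // subr0.
  rewrite !fps_coefM; apply: eq_bigr => j _; congr (_ * _).
  by rewrite (geom_coef n.+1) // ltnS leq_subr.
Qed.

End FpsUnits.

(** * Action of tensor powers of the enveloping algebra *)

Section LinearMaps.
Context {K : pzRingType} {V W : lmodType K} (f : V -> W).
Context (f_lin : linear f).

Lemma linear_add u v : f (u + v) = f u + f v.
Proof. by have := f_lin 1 u v; rewrite !scale1r. Qed.

Lemma linear_zero : f 0 = 0.
Proof. by apply: (addrI (f 0)); rewrite -linear_add !addr0. Qed.

Lemma linear_scale c u : f (c *: u) = c *: f u.
Proof. by have := f_lin c u 0; rewrite linear_zero !addr0. Qed.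

Lemma linear_opp u : f (- u) = - f u.
Proof. by rewrite -scaleN1r linear_scale scaleN1r. Qed.

Lemma linear_sumE I (s : seq I) (F : I -> V) :
  f (\sum_(i <- s) F i) = \sum_(i <- s) f (F i).
Proof.
elim: s => [|i s IHs]; first by rewrite !big_nil linear_zero.
by rewrite !big_cons linear_add IHs.
Qed.

End LinearMaps.

Record representation (K : fieldType) (g : lieAlgebra K) (A : lmodType K)
    (rho : g -> A -> A) : Prop := Representation {
  rep_linear : forall x, linear (rho x);
  rep_linearl : forall v, linear (rho^~ v);
  rep_bracket : forall x y v,
    rho (bracket x y) v = rho x (rho y v) - rho y (rho x v)
}.

Section EnvelopingAction.
Context {K : fieldType} {g : lieAlgebra K} {A : lmodType K}.
Context {rho : g -> A -> A} (rhoP : representation rho).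

Lemma aact_linear t : linear (aact rho t).
Proof.
elim: t => [x||| t IHt|c t IHt|t IHt u IHu|t IHt u IHu] d v w /=.
- exact: rep_linear.
- by rewrite scaler0 addr0.
- by [].
- by rewrite IHt opprD scalerN.
- by rewrite IHt scalerDr !scalerA mulrC.
- by rewrite IHt IHu scalerDr addrACA.
- by rewrite IHu IHt.
Qed.

(** The relations of [env] hold for the operators of a representation; this is
    what makes [env_act] independent of the representative that defines it. *)
Lemma aact_acong t u v : acong (P := env_presentation g) t u ->
  aact rho t v = aact rho u v.
Proof.
move=> tu; elim: tu v => //=; clear t u.
- move=> t u; case=> [x y|c x|x y] v /=.
  + exact: linear_add (rep_linearl rhoP v) x y.
  + exact: linear_scale (rep_linearl rhoP v) c x.
  + exact: rep_bracket.
- by move=> t u v _ tu _ uv w; rewrite tu uv.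
- by move=> t u _ tu w; rewrite tu.
- by move=> c t u _ tu w; rewrite tu.
- by move=> t t' u u' _ tt' _ uu' w; rewrite tt' uu'.
- by move=> t t' u u' _ tt' _ uu' w; rewrite uu' tt'.
- by move=> *; rewrite addrA.
- by move=> *; rewrite addrC.
- by move=> *; rewrite add0r.
- by move=> *; rewrite addNr.
- by move=> t u w v; rewrite (linear_add (aact_linear t)).
- by move=> *; rewrite scalerA.
- by move=> *; rewrite scale1r.
- by move=> *; rewrite scalerDr.
- by move=> *; rewrite scalerDl.
- by move=> a t u w; rewrite (linear_scale (aact_linear t)).
Qed.

Lemma env_act_pclass t v :
  env_act rho (pclass (P := env_presentation g) t) v = aact rho t v.
Proof. by apply: aact_acong; exact: acong_prepr. Qed.

Lemma env_act_linear b : linear (env_act rho b).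
Proof. exact: aact_linear. Qed.

Lemma env_act_inj x v : env_act rho (env_inj x) v = rho x v.
Proof. exact: env_act_pclass. Qed.

Lemma env_act1 v : env_act rho 1 v = v.
Proof. by rewrite -[1](pclass1 (env_presentation g)) env_act_pclass. Qed.

Lemma env_actD a b v : env_act rho (a + b) v = env_act rho a v + env_act rho b v.
Proof. by rewrite -(preprK a) -(preprK b) -pclassD !env_act_pclass. Qed.

Lemma env_actZ c a v : env_act rho (c *: a) v = c *: env_act rho a v.
Proof. by rewrite -(preprK a) -pclassZ !env_act_pclass. Qed.

Lemma env_actM a b v : env_act rho (a * b) v = env_act rho a (env_act rho b v).
Proof. by rewrite -(preprK a) -(preprK b) -pclassM !env_act_pclass. Qed.

End EnvelopingAction.

Section Update.
Context {n : nat} {A : Type}.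
Implicit Types (x : 'I_n -> A) (i j : 'I_n) (u v : A).

Definition upd x i u : 'I_n -> A := fun j => if j == i then u else x j.

Lemma upd_same x i u : upd x i u i = u. Proof. by rewrite /upd eqxx. Qed.

Lemma upd_other x i j u : j != i -> upd x i u j = x j.
Proof. by rewrite /upd => /negPf ->. Qed.

Lemma upd_id x i : upd x i (x i) = x.
Proof. by apply/funext => j; rewrite /upd; case: eqP => // ->. Qed.

Lemma upd_upd x i u v : upd (upd x i u) i v = upd x i v.
Proof. by apply/funext => j; rewrite /upd; case: eqP. Qed.

Lemma updC x i j u v : i != j -> upd (upd x i u) j v = upd (upd x j v) i u.
Proof.
move=> ij; apply/funext => l; rewrite /upd.
by case: eqP => // ->; rewrite eq_sym (negPf ij).
Qed.

End Update.

Section TensorActions.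
Context {K : fieldType} {g : lieAlgebra K} {A W : lmodType K}.
Context {rho : g -> A -> A} (rhoP : representation rho) {n : nat}.
Local Notation act := (env_act rho).
Local Notation expr := (aexpr K ('I_n * env g)).
Implicit Types (t : expr) (T : ('I_n -> A) -> W) (u : tens g n).

Definition multilinear (V : lmodType K) (T : ('I_n -> A) -> V) : Prop :=
  forall i x, linear (fun v => T (upd x i v)).

Lemma precomp_gen i b T x :
  precomp rho (AGen (i, b)) T x = T (upd x i (act b (x i))).
Proof. by congr T; apply/funext => j; rewrite /upd /=; case: eqP => // ->. Qed.

Lemma precomp_add (t u : expr) T x :
  precomp rho (AAdd t u) T x = precomp rho t T x + precomp rho u T x.
Proof. by []. Qed.

Lemma precomp_scale c (t : expr) T x :
  precomp rho (AScale c t) T x = c *: precomp rho t T x.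
Proof. by []. Qed.

Lemma precomp_mul (t u : expr) T x :
  precomp rho (AMul t u) T x = precomp rho u (precomp rho t T) x.
Proof. by []. Qed.

(** Linearity in [T], as opposed to linearity in the arguments of [T]. *)
Lemma precomp_linear t c T T' x :
  precomp rho t (fun y => c *: T y + T' y) x
  = c *: precomp rho t T x + precomp rho t T' x.
Proof.
elim: t T T' x => [ib||| t IHt|d t IHt|t IHt u IHu|t IHt u IHu] T T' x //=.
- by rewrite scaler0 addr0.
- by rewrite IHt opprD scalerN.
- by rewrite IHt scalerDr !scalerA mulrC.
- by rewrite IHt IHu scalerDr addrACA.
- by rewrite -IHu; congr (precomp rho u _ x); apply/funext => y; exact: IHt.
Qed.

Lemma precomp_multilinear t T : multilinear T -> multilinear (precomp rho t T).
Proof.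
elim: t T => [[i b]||| t IHt|d t IHt|t IHt u IHu|t IHt u IHu] T Tl j x c v w.
- rewrite !precomp_gen; have [->|ij] := eqVneq i j.
    by rewrite !upd_same !upd_upd (env_act_linear rhoP) Tl.
  by rewrite !(upd_other _ _ ij) !(updC _ _ _ (_ : j != i)) 1?eq_sym // Tl.
- by rewrite /= scaler0 addr0.
- exact: Tl.
- by rewrite /= IHt // opprD scalerN.
- by rewrite /= IHt // scalerDr !scalerA mulrC.
- by rewrite /= IHt // IHu // scalerDr addrACA.
- by rewrite /= IHu //; exact: IHt.
Qed.

Lemma precompZ_fun t c T x :
  precomp rho t (fun y => c *: T y) x = c *: precomp rho t T x.
Proof.
have := precomp_linear t (-1) (fun=> 0) (fun=> 0) x.
under eq_fun do rewrite scaler0 addr0.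
rewrite scaleN1r addNr => z; have := precomp_linear t c T (fun=> 0) x.
by rewrite z addr0; under eq_fun do rewrite addr0.
Qed.

Lemma precompD_fun t T T' x :
  precomp rho t (fun y => T y + T' y) x = precomp rho t T x + precomp rho t T' x.
Proof.
have := precomp_linear t 1 T T' x; rewrite scale1r => <-.
by under [in RHS]eq_fun do rewrite scale1r.
Qed.

Lemma precomp0_fun t x : precomp rho t (fun=> 0 : W) x = 0.
Proof.
have := precompZ_fun t 0 (fun=> 0) x.
by under eq_fun do rewrite scale0r; rewrite scale0r.
Qed.

(** The generators at different positions commute only because they act on
    different arguments, and those at one position satisfy the relations of
    [env] only because [T] is linear in each argument: multilinearity is what
    makes [tens_precomp] independent of representatives. *)
Lemma precomp_acong t t' T x : acong (P := tens_presentation g n) t t' ->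
  multilinear T -> precomp rho t T x = precomp rho t' T x.
Proof.
move=> tt'; elim: tt' T x => //=; clear t t'.
- move=> t u; case=> [i a b|i c a|i|i a b|i j a b ij] T x Tl;
    rewrite ?precomp_gen ?precomp_add ?precomp_scale ?precomp_mul ?precomp_gen.
  + by rewrite (env_actD rhoP) (linear_add (Tl i x)).
  + by rewrite (env_actZ rhoP) (linear_scale (Tl i x)).
  + by rewrite (env_act1 rhoP) upd_id.
  + by rewrite upd_same upd_upd (env_actM rhoP).
  + rewrite (upd_other _ _ ij) [in RHS]upd_other 1?eq_sym //.
    by rewrite updC // eq_sym.
- by move=> t u _ tu T x Tl; rewrite tu.
- by move=> t u v _ tu _ uv T x Tl; rewrite tu ?uv.
- by move=> t u _ tu T x Tl; rewrite tu.
- by move=> c t u _ tu T x Tl; rewrite tu.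
- by move=> t t' u u' _ tt' _ uu' T x Tl; rewrite tt' ?uu'.
- move=> t t' u u' _ tt' _ uu' T x Tl.
  rewrite uu'; last exact: precomp_multilinear.
  by congr (precomp rho u' _ x); apply/funext => y; exact: tt'.
- by move=> *; rewrite addrA.
- by move=> *; rewrite addrC.
- by move=> *; rewrite add0r.
- by move=> *; rewrite addNr.
- by move=> t u v T x Tl; rewrite precompD_fun.
- by move=> *; rewrite scalerA.
- by move=> *; rewrite scale1r.
- by move=> *; rewrite scalerDr.
- by move=> *; rewrite scalerDl.
- by move=> a t u T x Tl; rewrite precompZ_fun.
Qed.

Lemma tens_precomp_pclass t T x : multilinear T ->
  tens_precomp rho (pclass (P := tens_presentation g n) t) T x = precomp rho t T x.
Proof. by move=> Tl; apply: precomp_acong => //; exact: acong_prepr. Qed.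

Lemma tens_precomp_multilinear u T :
  multilinear T -> multilinear (tens_precomp rho u T).
Proof. exact: precomp_multilinear. Qed.

Lemma tens_precomp1 T x : multilinear T -> tens_precomp rho (1 : tens g n) T x = T x.
Proof.
by move=> Tl; rewrite -[1](pclass1 (tens_presentation g n)) tens_precomp_pclass.
Qed.

Lemma tens_precomp0 T x : multilinear T -> tens_precomp rho (0 : tens g n) T x = 0.
Proof.
by move=> Tl; rewrite -[0](pclass0 (tens_presentation g n)) tens_precomp_pclass.
Qed.

Lemma tens_precompD u v T x : multilinear T ->
  tens_precomp rho (u + v) T x = tens_precomp rho u T x + tens_precomp rho v T x.
Proof.
by move=> Tl; rewrite -(preprK u) -(preprK v) -pclassD !tens_precomp_pclass.
Qed.

Lemma tens_precompN u T x : multilinear T ->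
  tens_precomp rho (- u) T x = - tens_precomp rho u T x.
Proof.
by move=> Tl; rewrite -(preprK u) -pclassN !tens_precomp_pclass.
Qed.

Lemma tens_precompZ c u T x : multilinear T ->
  tens_precomp rho (c *: u) T x = c *: tens_precomp rho u T x.
Proof.
by move=> Tl; rewrite -(preprK u) -pclassZ !tens_precomp_pclass.
Qed.

Lemma tens_precomp_sum I (s : seq I) (F : I -> tens g n) T x : multilinear T ->
  tens_precomp rho (\sum_(i <- s) F i) T x = \sum_(i <- s) tens_precomp rho (F i) T x.
Proof.
move=> Tl; elim: s => [|i s IHs]; first by rewrite !big_nil tens_precomp0.
by rewrite !big_cons tens_precompD // IHs.
Qed.

Lemma tens_precompM u v T x : multilinear T ->
  tens_precomp rho (u * v) T x = tens_precomp rho v (tens_precomp rho u T) x.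
Proof.
move=> Tl; rewrite -[u in LHS]preprK -[v in LHS]preprK -pclassM.
by rewrite tens_precomp_pclass.
Qed.

Lemma tens_precomp_slot i b T x : multilinear T ->
  tens_precomp rho (slot i b) T x = T (upd x i (act b (x i))).
Proof. by move=> Tl; rewrite tens_precomp_pclass // precomp_gen. Qed.

Lemma tens_precompD_fun u T T' x :
  tens_precomp rho u (fun y => T y + T' y) x
  = tens_precomp rho u T x + tens_precomp rho u T' x.
Proof. exact: precompD_fun. Qed.

Lemma tens_precomp_sum_fun I (s : seq I) u (F : I -> ('I_n -> A) -> W) x :
  tens_precomp rho u (fun y => \sum_(i <- s) F i y) x
  = \sum_(i <- s) tens_precomp rho u (F i) x.
Proof.
elim: s => [|i s IHs].
  by rewrite big_nil; under eq_fun do rewrite big_nil; exact: precomp0_fun.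
by rewrite big_cons -IHs -tens_precompD_fun; under eq_fun do rewrite big_cons.
Qed.

End TensorActions.

Lemma tens_precomp_comp (K : fieldType) (g : lieAlgebra K) (A V W : lmodType K)
    (rho : g -> A -> A) (n : nat) (u : tens g n) (L : V -> W) T (x : 'I_n -> A) :
  linear L ->
  tens_precomp rho u (fun y => L (T y)) x = L (tens_precomp rho u T x).
Proof.
move=> Ll; rewrite /tens_precomp; elim: (prepr u) T x => {u}
  [ib||| t IHt|d t IHt|t IHt u IHu|t IHt u IHu] T x //=.
- by rewrite linear_zero.
- by rewrite IHt linear_opp.
- by rewrite IHt linear_scale.
- by rewrite IHt IHu linear_add.
- by rewrite -IHu; congr (precomp rho u _ x); apply/funext => y; exact: IHt.
Qed.

Section FormalTensorActions.
Context {K : fieldType} {g : lieAlgebra K} {A W : lmodType K}.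
Context {rho : g -> A -> A} (rhoP : representation rho) {n : nat}.
Implicit Types (u v : fps (tens g n)) (T : ('I_n -> A) -> fps W).

Lemma fps_coef_linear k : linear (fun a : fps W => a k).
Proof. by []. Qed.

Lemma multilinear_coef T k : multilinear T -> multilinear (fun y => T y k).
Proof. by move=> Tl i x c a b; rewrite Tl. Qed.

Lemma fps_precompE u T x k :
  fps_precomp rho u T x k =
  \sum_(j < k.+1) tens_precomp rho (u j) (fun y => T y (k - j)%N) x.
Proof.
apply: eq_bigr => j _.
by rewrite (tens_precomp_comp rho (u j) T x (fps_coef_linear (k - j))).
Qed.

Lemma fps_precomp_multilinear u T :
  multilinear T -> multilinear (fps_precomp rho u T).
Proof.
move=> Tl i x c a b; apply/funext => k.
rewrite [RHS](_ : _ = c *: fps_precomp rho u T (upd x i a) k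
  + fps_precomp rho u T (upd x i b) k) // !fps_precompE scaler_sumr -big_split /=.
apply: eq_bigr => j _.
by rewrite (tens_precomp_multilinear rhoP (u j) (multilinear_coef (k - j) Tl)).
Qed.

(** In degree [k], both sides are the sum of [tens_precompM] over the triples of
    degrees with sum [k], for [u], [v] and [T]. *)
Lemma fps_precompM u v T : multilinear T ->
  fps_precomp rho (u * v) T = fps_precomp rho v (fps_precomp rho u T).
Proof.
move=> Tl; apply/funext => x; apply/funext => k; rewrite !fps_precompE.
pose f i j l := tens_precomp rho (v j) (tens_precomp rho (u i) (fun y => T y l)) x.
transitivity (\sum_(i < k.+1) \sum_(j < i.+1) f j (i - j)%N (k - i)%N).
  apply: eq_bigr => i _; rewrite fps_coefM.
  rewrite (tens_precomp_sum rhoP) //; last exact: multilinear_coef.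
  apply: eq_bigr => j _; rewrite (tens_precompM rhoP) //; exact: multilinear_coef.
rewrite triangular_diagonal (triangular_exchange k (fun j i => f j i (k - j - i)%N)).
apply: eq_bigr => i _; rewrite /f.
under eq_bigr => j _ do rewrite subnAC.
rewrite -tens_precomp_sum_fun; congr (tens_precomp rho (v i) _ x).
by apply/funext => y; rewrite fps_precompE.
Qed.

Lemma fps_precomp_cst (b : tens g n) T x k : multilinear T ->
  fps_precomp rho (fps_cst b) T x k = tens_precomp rho b (fun y => T y k) x.
Proof.
move=> Tl; rewrite fps_precompE big_ord_recl /= subn0 big1 ?addr0 // => j _.
by rewrite (tens_precomp0 rhoP) //; exact: multilinear_coef.
Qed.

Lemma fps_precomp1 T : multilinear T -> fps_precomp rho 1 T = T.
Proof.
move=> Tl; apply/funext => x; apply/funext => k.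
rewrite -[1]/(fps_cst 1) fps_precomp_cst // (tens_precomp1 rhoP) //.
exact: multilinear_coef.
Qed.

Lemma fps_precomp_coef0 u T x : multilinear T -> u 0%N = 1 ->
  fps_precomp rho u T x 0%N = T x 0%N.
Proof.
move=> Tl u0; rewrite fps_precompE big_ord1 u0 (tens_precomp1 rhoP) //.
exact: multilinear_coef.
Qed.

End FormalTensorActions.

(** * Iterated comultiplications *)

Section PresentedLifts.
Context {K : comNzRingType} {P : presentation K} {B : algType K}.
Context {f : pgen P -> B}.

Lemma aeval_comm z t :
  (forall x, GRing.comm z (f x)) -> GRing.comm z (aeval f t).
Proof.
move=> zf; elim: t => [x||| t IHt|c t IHt|t IHt u IHu|t IHt u IHu] /=.
- exact: zf.
- exact: commr0.
- exact: commr1.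
- exact: commrN.
- by rewrite /GRing.comm -scalerAr -scalerAl IHt.
- exact: commrD.
- exact: commrM.
Qed.

Lemma plift_pclass t : (forall t u, prel t u -> aeval f t = aeval f u) ->
  plift f (pclass t) = aeval f t.
Proof. by move=> fP; apply: (aeval_acong fP); exact: acong_prepr. Qed.

End PresentedLifts.

Lemma commutatorD (A : pzRingType) (a b p q : A) :
  GRing.comm a q -> GRing.comm b p ->
  (a + p) * (b + q) - (b + q) * (a + p) = (a * b - b * a) + (p * q - q * p).
Proof.
move=> aq bp; rewrite !mulrDl !mulrDr aq bp.
rewrite [p * b + p * q]addrC [q * a + q * p]addrC addrACA.
rewrite [b * a + p * b + _]addrACA [p * b + q * a]addrC opprD.
by rewrite (addrACA _ (q * a + p * b)) subrr addr0 opprD addrACA.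
Qed.

Section Coproducts.
Context {K : fieldType} {g : lieAlgebra K}.

Lemma env_injD (x y : g) : env_inj (x + y) = env_inj x + env_inj y.
Proof. by rewrite -pclassD; apply/pclassP/ac_rel; exact: env_add. Qed.

Lemma env_injZ c (x : g) : env_inj (c *: x) = c *: env_inj x.
Proof. by rewrite -pclassZ; apply/pclassP/ac_rel; exact: env_scale. Qed.

Lemma env_inj_bracket (x y : g) :
  env_inj (bracket x y) = env_inj x * env_inj y - env_inj y * env_inj x.
Proof.
rewrite -!pclassM -pclassN -pclassD.
by apply/pclassP/ac_rel; exact: env_bracket.
Qed.

Section Slots.
Context {n : nat}.
Implicit Types (i j : 'I_n) (a b : env g).

Lemma slotD i a b : slot i (a + b) = slot i a + slot i b.
Proof. by rewrite -pclassD; apply/pclassP/ac_rel; exact: tens_add. Qed.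

Lemma slotZ i c a : slot i (c *: a) = c *: slot i a.
Proof. by rewrite -pclassZ; apply/pclassP/ac_rel; exact: tens_scale. Qed.

Lemma slotM i a b : slot i (a * b) = slot i a * slot i b.
Proof. by rewrite -pclassM; apply/pclassP/ac_rel; exact: tens_mul. Qed.

Lemma slotN i a : slot i (- a) = - slot i a.
Proof. by rewrite -scaleN1r slotZ scaleN1r. Qed.

Lemma slot_comm i j a b : i != j -> GRing.comm (slot i a) (slot j b).
Proof.
by move=> ij; rewrite /GRing.comm -!pclassM; apply/pclassP/ac_rel; exact: tens_comm.
Qed.

End Slots.

Context {m : nat}.
Implicit Types (s : seq nat) (x y : g) (a b : env g).

(** The iterated coproduct of [x] at the positions of [s]: elements of [g] are
    primitive. *)
Definition primitive_sum s x : tens g m.+1 :=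
  \sum_(i <- s) slot (inord i) (env_inj x).

Lemma primitive_sum_cons i s x :
  primitive_sum (i :: s) x = slot (inord i) (env_inj x) + primitive_sum s x.
Proof. exact: big_cons. Qed.

Lemma inord_neq i j : (i <= m)%N -> (j <= m)%N -> i != j ->
  inord i != inord j :> 'I_m.+1.
Proof.
move=> im jm; apply: contra => /eqP /(congr1 (@nat_of_ord _)).
by rewrite !inordK // => ->.
Qed.

Lemma slot_primitive_sum_comm i a s x :
  all (leq^~ m) (i :: s) -> i \notin s ->
  GRing.comm (slot (inord i) a) (primitive_sum s x).
Proof.
move=> /= /andP[im sm] nis; rewrite /primitive_sum big_seq.
apply: commr_sum => j js; apply: slot_comm; apply: inord_neq => //.
  exact: (allP sm).
by apply: contraNneq nis => ->.
Qed.

Lemma primitive_sum_comm s s' x y : all (leq^~ m) (s ++ s') -> ~~ has (mem s) s' ->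
  GRing.comm (primitive_sum s x) (primitive_sum s' y).
Proof.
move=> + /hasPn ss'; rewrite all_cat => /andP[sm s'm].
apply: commr_sym; rewrite {2}/primitive_sum big_seq; apply: commr_sum => i si.
apply: commr_sym; apply: slot_primitive_sum_comm.
  by rewrite /= s'm (allP sm).
by apply/negP => /ss'; rewrite /= si.
Qed.

(** Only the terms at equal positions survive in the commutator, since the
    positions are distinct. *)
Lemma primitive_sum_bracket s x y : uniq s -> all (leq^~ m) s ->
  primitive_sum s (bracket x y) =
  primitive_sum s x * primitive_sum s y - primitive_sum s y * primitive_sum s x.
Proof.
elim: s => [|i s IHs] /=.
  by rewrite /primitive_sum !big_nil mulr0 subrr.
move=> /andP[nis us] /andP[im sm]; rewrite !primitive_sum_cons IHs //.
have c a z : GRing.comm (slot (inord i) a) (primitive_sum s z).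
  by apply: slot_primitive_sum_comm => //=; rewrite im.
by rewrite commutatorD // -!slotM -slotN -slotD -env_inj_bracket.
Qed.

Lemma cop_compatible s : uniq s -> all (leq^~ m) s ->
  forall t u, env_rel (g := g) t u ->
  aeval (primitive_sum s) t = aeval (primitive_sum s) u.
Proof.
move=> us sm t u; case=> [x y|c x|x y] /=; last exact: primitive_sum_bracket.
- rewrite /primitive_sum -big_split /=.
  by apply: eq_bigr => i _; rewrite env_injD slotD.
- rewrite /primitive_sum scaler_sumr.
  by apply: eq_bigr => i _; rewrite env_injZ slotZ.
Qed.

Lemma cop_pclass s t : uniq s -> all (leq^~ m) s ->
  cop m s (pclass (P := env_presentation g) t) = aeval (primitive_sum s) t.
Proof. by move=> us sm; apply: plift_pclass; exact: cop_compatible. Qed.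

(** Disjoint sets of positions give commuting images; this is the relation
    that [tens_cop] has to respect between different factors. *)
Lemma cop_comm s s' a b : all (leq^~ m) (s ++ s') -> ~~ has (mem s) s' ->
  GRing.comm (cop m s a) (cop m s' b).
Proof.
move=> sm ss'; apply: aeval_comm => y; apply/commr_sym/aeval_comm => x.
exact/commr_sym/primitive_sum_comm.
Qed.

Lemma nth_flatten_sub (ss : seq (seq nat)) k :
  {subset nth [::] ss k <= flatten ss}.
Proof.
elim: ss k => [|s ss IHss] [|k] // i /= si; rewrite mem_cat ?si //.
by rewrite (IHss k) ?orbT.
Qed.

Lemma uniq_nth_flatten (ss : seq (seq nat)) k :
  uniq (flatten ss) -> uniq (nth [::] ss k).
Proof.
by elim: ss k => [|s ss IHss] [|k] //=; rewrite cat_uniq => /and3P[] // _ _ /IHss.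
Qed.

Lemma nth_flatten_disjoint (ss : seq (seq nat)) k l : k != l ->
  uniq (flatten ss) -> ~~ has (mem (nth [::] ss k)) (nth [::] ss l).
Proof.
elim: ss k l => [|s ss IHss] [|k] [|l] //= kl;
  rewrite cat_uniq => /and3P[_ /hasPn s_ss uss].
- by apply/hasPn => i /(@nth_flatten_sub _ l); exact: s_ss.
- apply/hasPn => i si; apply/negP => /(@nth_flatten_sub _ k) /s_ss.
  by rewrite /= si.
- exact: IHss.
Qed.

(** The value at 1 is computed from an arbitrary representative of 1, so it
    takes all the relations of [tens], respected thanks to the disjointness of
    the blocks. *)
Lemma tens_cop1 n (ss : seq (seq nat)) :
  uniq (flatten ss) -> all (leq^~ m) (flatten ss) ->
  tens_cop n m ss (1 : tens g n) = 1.
Proof.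
move=> uss ssm; rewrite -[1 in LHS](pclass1 (tens_presentation g n)).
have bound k : all (leq^~ m) (nth [::] ss k).
  by apply/allP => i ki; apply: (allP ssm); exact: nth_flatten_sub ki.
have copE k t := cop_pclass t (uniq_nth_flatten k uss) (bound k).
rewrite /tens_cop plift_pclass // => t u; case=> [i a b|i c a|i|i a b|i j a b ij] /=.
- by rewrite -(preprK a) -(preprK b) -pclassD !copE.
- by rewrite -(preprK a) -pclassZ !copE.
- by rewrite -[1 in LHS](pclass1 (env_presentation g)) copE.
- by rewrite -(preprK a) -(preprK b) -pclassM !copE.
- apply: cop_comm; first by rewrite all_cat !bound.
  exact: nth_flatten_disjoint.
Qed.

End Coproducts.

(** * Acting through a comultiplication *)

Section CoproductAction.
Context {K : fieldType} {g : lieAlgebra K} {A W : lmodType K}.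
Context {rho : g -> A -> A} (rhoP : representation rho).
Context {n m : nat} (ss : seq (seq nat)).
Context (q : ('I_m.+1 -> A) -> 'I_n -> A).
Local Notation block k := (nth [::] ss k).

(** The map [q] sends [m.+1] arguments to [n] of them, the [k]-th one being a
    function of the arguments in block [k] on which [g] acts by the Leibniz
    rule: for instance [(x, y, z) |-> (mu (x, y), z)], with blocks
    [[:: 0; 1]] and [[:: 2]], for an invariant [mu]. *)
Record equivariant : Prop := Equivariant {
  eqv_act : forall (k : 'I_n) y x,
    rho x (q y k) =
    \sum_(i <- block k) q (upd y (inord i) (rho x (y (inord i)))) k;
  eqv_other : forall (k k' : 'I_n) y i a, k' != k -> i \in block k ->
    q (upd y (inord i) a) k' = q y k'
}.
Context (qP : equivariant).

(** In [T y (q y)], the arguments [y] outside of all blocks appear through the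
    first argument of [T]. *)
Record compatible (T : ('I_m.+1 -> A) -> ('I_n -> A) -> W) : Prop := Compatible {
  compat_indep : forall (k : 'I_n) y i a, i \in block k ->
    T (upd y (inord i) a) = T y;
  compat_lin : forall y, multilinear (T y);
  compat_comp : multilinear (fun y => T y (q y))
}.

(** The Leibniz rule of [equivariant], for elements of [g], propagates to
    products; the induction changes [T], since the product of two expressions
    precomposes [T] with the first one and then acts by the second one. *)
Lemma aeval_primitive_precomp (e : aexpr K g) (k : 'I_n) T y : compatible T ->
  tens_precomp rho (aeval (primitive_sum (m := m) (block k)) e)
    (fun z => T z (q z)) y
  = T y (upd (q y) k (aact rho e (q y k))).
Proof.
elim: e T y => [x||| e IHe|c e IHe|e IHe f IHf|e IHe f IHf] T y TP /=;
  have [Ti Tl Tc] := TP; have Tk := Tl y k (q y).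
- rewrite (tens_precomp_sum rhoP) // (eqv_act qP) (linear_sumE Tk) big_seq [RHS]big_seq.
  apply: eq_bigr => i ik; rewrite (tens_precomp_slot rhoP) // (env_act_inj rhoP).
  rewrite (Ti k) //; congr (T y _); apply/funext => k'.
  have [->|kk'] := eqVneq k' k; first by rewrite upd_same.
  by rewrite upd_other // (eqv_other qP _ _ kk').
- by rewrite (tens_precomp0 rhoP) // (linear_zero Tk).
- by rewrite (tens_precomp1 rhoP) // upd_id.
- by rewrite (tens_precompN rhoP) // IHe // (linear_opp Tk).
- by rewrite (tens_precompZ rhoP) // IHe // (linear_scale Tk).
- by rewrite (tens_precompD rhoP) // IHe // IHf // (linear_add Tk).
- rewrite (tens_precompM rhoP) //.
  pose S z v := T z (upd v k (aact rho e (v k))).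
  have SE : tens_precomp rho (aeval (primitive_sum (block k)) e)
      (fun z => T z (q z)) = fun z => S z (q z).
    by apply/funext => z; exact: IHe.
  rewrite SE IHf /S ?upd_same ?upd_upd //; split=> [l z i a il|z|].
  + by rewrite /S (Ti l).
  + have := precomp_multilinear rhoP
      (AGen (k, pclass (P := env_presentation g) e)) (Tl z).
    congr multilinear; apply/funext => v.
    by rewrite precomp_gen (env_act_pclass rhoP).
  + by rewrite -SE; exact: tens_precomp_multilinear.
Qed.

(** Acting on the values of [q] is acting on its arguments through the
    comultiplication.  All the computations with [Delta (x) id],
    [id (x) Delta], [F (x) 1], [1 (x) F] and the counits reduce to this. *)
Lemma tens_cop_precomp (u : tens g n) T y : compatible T ->
  tens_precomp rho (tens_cop n m ss u) (fun z => T z (q z)) y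
  = tens_precomp rho u (T y) (q y).
Proof.
rewrite /tens_cop /plift {2}/tens_precomp.
elim: (prepr u) T y => {u} [[k b]||| t IHt|c t IHt|t IHt u IHu|t IHt u IHu] T y TP;
  have [Ti Tl Tc] := TP; rewrite ?precomp_gen /=.
- exact: aeval_primitive_precomp.
- by rewrite (tens_precomp0 rhoP).
- by rewrite (tens_precomp1 rhoP).
- by rewrite (tens_precompN rhoP) // IHt.
- by rewrite (tens_precompZ rhoP) // IHt.
- by rewrite (tens_precompD rhoP) // IHt // IHu.
- rewrite (tens_precompM rhoP) //.
  have SE : tens_precomp rho
      (aeval (fun ia : 'I_n * env g => cop m (nth [::] ss ia.1) ia.2) t)
      (fun z => T z (q z)) = fun z => precomp rho t (T z) (q z).
    by apply/funext => z; exact: IHt.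
  rewrite SE (IHu (fun z => precomp rho t (T z))) //; split=> [l z i a il|z|].
  + by rewrite (Ti l).
  + exact: precomp_multilinear.
  + by rewrite -SE; exact: tens_precomp_multilinear.
Qed.

End CoproductAction.

(** * Binary operations and their composites *)

Section Pairs.
Context {A : Type}.

Definition pair2 (a b : A) : 'I_2 -> A := tnth [tuple a; b].

Lemma pair2_eta (v : 'I_2 -> A) : pair2 (v ord0) (v ord_max) = v.
Proof.
apply/funext => k; rewrite /pair2 (tnth_nth (v ord0)).
by case: k => [[|[|k]] lt_k2] //=; congr v; exact: val_inj.
Qed.

Lemma upd_pair2_0 (a b c : A) : upd (pair2 a b) ord0 c = pair2 c b.
Proof. by rewrite -[LHS]pair2_eta. Qed.

Lemma upd_pair2_1 (a b c : A) : upd (pair2 a b) ord_max c = pair2 a c.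
Proof. by rewrite -[LHS]pair2_eta. Qed.

Lemma ord2P (P : 'I_2 -> Prop) : P ord0 -> P ord_max -> forall k, P k.
Proof.
move=> P0 P1 [[|[|k]] lt_k2] //.
- by rewrite (_ : Ordinal _ = ord0) //; exact: val_inj.
- by rewrite (_ : Ordinal _ = ord_max) //; exact: val_inj.
Qed.

Lemma ord3P (P : 'I_3 -> Prop) : P ord0 -> P (inord 1) -> P ord_max -> forall k, P k.
Proof.
move=> P0 P1 P2 [[|[|[|k]]] lt_k3] //.
- by rewrite (_ : Ordinal _ = ord0) //; exact: val_inj.
- by rewrite (_ : Ordinal _ = inord 1) //; apply: val_inj; rewrite /= inordK.
- by rewrite (_ : Ordinal _ = ord_max) //; exact: val_inj.
Qed.

End Pairs.

Section Convolutions.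
Context {K : fieldType} {g : lieAlgebra K} {A : lmodType K}.
Context {rho : g -> A -> A} {n : nat}.
Implicit Types (S : nat -> nat -> ('I_n -> A) -> A) (u : fps (tens g n)).

(** The coefficients of the composite of two formal series of operations, where
    [S k i] is the composite of the outer coefficient [k] with the inner
    coefficient [i]. *)
Definition convolution S : ('I_n -> A) -> fps A :=
  fun v k => \sum_(i < k.+1) S (k - i)%N i v.

Lemma convolution_multilinear S :
  (forall k i, multilinear (S k i)) -> multilinear (convolution S).
Proof.
move=> Sl i x c a b; apply/funext => k.
rewrite [RHS](_ : _ = c *: convolution S (upd x i a) k
  + convolution S (upd x i b) k) //.
by rewrite scaler_sumr -big_split; apply: eq_bigr => j _; rewrite Sl.
Qed.

(** The twist changes the inner operation: [S' k i] collects the [S k (i - l)],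
    the outer index being fixed. *)
Lemma convolution_precomp_inner u S S' :
  (forall k i v, S' k i v = \sum_(l < i.+1) tens_precomp rho (u l) (S k (i - l)%N) v) ->
  fps_precomp rho u (convolution S) = convolution S'.
Proof.
move=> S'E; apply/funext => v; apply/funext => k; rewrite fps_precompE /convolution.
under eq_bigr => l _ do rewrite tens_precomp_sum_fun.
under [RHS]eq_bigr => i _ do rewrite S'E.
by rewrite (triangular_diagonal k
  (fun l i j => tens_precomp rho (u l) (S j i) v)).
Qed.

Lemma convolution_precomp_outer u S S' :
  (forall k i v, S' k i v = \sum_(l < k.+1) tens_precomp rho (u l) (S (k - l)%N i) v) ->
  fps_precomp rho u (convolution S) = convolution S'.
Proof.
move=> S'E; apply/funext => v; apply/funext => k; rewrite fps_precompE /convolution.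
under eq_bigr => l _ do rewrite tens_precomp_sum_fun.
under [RHS]eq_bigr => i _ do rewrite S'E.
rewrite (triangular_exchange k
  (fun l i => tens_precomp rho (u l) (S (k - l - i)%N i) v)).
by apply: eq_bigr => i _; apply: eq_bigr => l _; rewrite subnAC.
Qed.

End Convolutions.

Section PairsAndTriples.
Context {A : Type}.

Lemma pair2_0 (a b : A) : pair2 a b ord0 = a. Proof. by []. Qed.

Lemma pair2_1 (a b : A) : pair2 a b ord_max = b. Proof. by []. Qed.

Lemma inord0 m : inord 0 = ord0 :> 'I_m.+1.
Proof. by apply: val_inj; rewrite /= inordK. Qed.

Lemma inord_max m : inord m = ord_max :> 'I_m.+1.
Proof. by apply: val_inj; rewrite /= inordK. Qed.

Lemma upd_inord m (v : 'I_m.+1 -> A) i j a : (i <= m)%N -> (j <= m)%N ->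
  upd v (inord i) a (inord j) = if j == i then a else v (inord j).
Proof.
move=> im jm; have [->|ji] := eqVneq j i; first exact: upd_same.
by rewrite upd_other // inord_neq.
Qed.

End PairsAndTriples.

Section BinaryOperations.
Context {K : fieldType} {g : lieAlgebra K} {A : lmodType K}.
Context {rho : g -> A -> A} (rhoP : representation rho).
Implicit Types B : A -> A -> A.

Record bilinear_op B : Prop := BilinearOp {
  bilin_l : forall y, linear (B^~ y);
  bilin_r : forall x, linear (B x)
}.

Definition on_pair B : ('I_2 -> A) -> A := fun v => B (v ord0) (v ord_max).

Definition invariant_op B : Prop :=
  forall x a b, rho x (B a b) = B (rho x a) b + B a (rho x b).

Definition left_comp B B' : ('I_3 -> A) -> A :=
  fun v => B (B' (v (inord 0)) (v (inord 1))) (v (inord 2)).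

Definition right_comp B B' : ('I_3 -> A) -> A :=
  fun v => B (v (inord 0)) (B' (v (inord 1)) (v (inord 2))).

Lemma on_pair_multilinear B : bilinear_op B -> multilinear (on_pair B).
Proof.
move=> [Bl Br]; elim/ord2P => x c a b; rewrite /on_pair ?upd_same !upd_other //.
- exact: Bl.
- exact: Br.
Qed.

Lemma left_comp_multilinear B B' :
  bilinear_op B -> bilinear_op B' -> multilinear (left_comp B B').
Proof.
move=> [Bl Br] [Bl' Br']; elim/ord3P => x c a b;
  rewrite -?inord0 -?inord_max /left_comp !upd_inord //=.
- by rewrite Bl' Bl.
- by rewrite Br' Bl.
- by rewrite Br.
Qed.

Lemma right_comp_multilinear B B' :
  bilinear_op B -> bilinear_op B' -> multilinear (right_comp B B').
Proof.
move=> [Bl Br] [Bl' Br']; elim/ord3P => x c a b;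
  rewrite -?inord0 -?inord_max /right_comp !upd_inord //=.
- exact: Bl.
- by rewrite Bl' Br.
- by rewrite Br' Br.
Qed.

(** Here and in the next three lemmas, [u] acts on [B (B' (x, y), z)] or on
    [B (x, B' (y, z))].  The action on the two arguments of [B'], through
    [u (x) 1] or [1 (x) u], is absorbed by [B']; the action through
    [(Delta (x) id) u] or [(id (x) Delta) u] is absorbed by [B], provided that
    [B'] is invariant. *)
Lemma tens_cop_left_inner u B B' v : bilinear_op B -> bilinear_op B' ->
  tens_precomp rho (tens_cop 2 2 [:: [:: 0]; [:: 1]]%N u) (left_comp B B') v
  = B (tens_precomp rho u (on_pair B') (pair2 (v (inord 0)) (v (inord 1))))
      (v (inord 2)).
Proof.
move=> Bl Bl'.
pose q (y : 'I_3 -> A) := pair2 (y (inord 0)) (y (inord 1)).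
pose T (y : 'I_3 -> A) w := B (on_pair B' w) (y (inord 2)).
have qP : equivariant (rho := rho) [:: [:: 0]; [:: 1]]%N q.
  split=> [|k k' y i a].
    by elim/ord2P => y x; rewrite big_seq1 /q ?pair2_0 ?pair2_1 upd_inord.
  elim/ord2P: k; elim/ord2P: k' => // _; rewrite inE => /eqP ->;
  by rewrite /q ?pair2_0 ?pair2_1 upd_inord.
have TP : compatible [:: [:: 0]; [:: 1]]%N q T.
  split=> [|y k x c a b|].
  - by elim/ord2P => y i a; rewrite inE => /eqP ->; rewrite /T upd_inord.
  - by rewrite /T (on_pair_multilinear Bl') (bilin_l Bl).
  - exact: (left_comp_multilinear Bl Bl').
rewrite (tens_cop_precomp rhoP qP u v TP).
exact: (tens_precomp_comp rho u (on_pair B') (q v) (bilin_l Bl (v (inord 2)))).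
Qed.

Lemma tens_cop_left_outer u B B' v :
  bilinear_op B -> bilinear_op B' -> invariant_op B' ->
  tens_precomp rho (tens_cop 2 2 [:: [:: 0; 1]; [:: 2]]%N u) (left_comp B B') v
  = tens_precomp rho u (on_pair B)
      (pair2 (B' (v (inord 0)) (v (inord 1))) (v (inord 2))).
Proof.
move=> Bl Bl' Bi'.
pose q (y : 'I_3 -> A) := pair2 (B' (y (inord 0)) (y (inord 1))) (y (inord 2)).
have qP : equivariant (rho := rho) [:: [:: 0; 1]; [:: 2]]%N q.
  split=> [|k k' y i a].
    by elim/ord2P => y x; rewrite big_cons ?big_cons big_nil addr0 /q
      ?pair2_0 ?pair2_1 ?Bi' !upd_inord.
  elim/ord2P: k; elim/ord2P: k' => // _; rewrite !inE.
    by case/orP => /eqP ->; rewrite /q !pair2_1 upd_inord.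
  by move=> /eqP ->; rewrite /q !pair2_0 !upd_inord.
have TP : compatible [:: [:: 0; 1]; [:: 2]]%N q (fun=> on_pair B).
  split=> // [y|]; first exact: on_pair_multilinear.
  exact: (left_comp_multilinear Bl Bl').
exact: (tens_cop_precomp rhoP qP u v TP).
Qed.

Lemma tens_cop_right_inner u B B' v : bilinear_op B -> bilinear_op B' ->
  tens_precomp rho (tens_cop 2 2 [:: [:: 1]; [:: 2]]%N u) (right_comp B B') v
  = B (v (inord 0))
      (tens_precomp rho u (on_pair B') (pair2 (v (inord 1)) (v (inord 2)))).
Proof.
move=> Bl Bl'.
pose q (y : 'I_3 -> A) := pair2 (y (inord 1)) (y (inord 2)).
pose T (y : 'I_3 -> A) w := B (y (inord 0)) (on_pair B' w).
have qP : equivariant (rho := rho) [:: [:: 1]; [:: 2]]%N q.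
  split=> [|k k' y i a].
    by elim/ord2P => y x; rewrite big_seq1 /q ?pair2_0 ?pair2_1 upd_inord.
  elim/ord2P: k; elim/ord2P: k' => // _; rewrite inE => /eqP ->;
  by rewrite /q ?pair2_0 ?pair2_1 upd_inord.
have TP : compatible [:: [:: 1]; [:: 2]]%N q T.
  split=> [|y k x c a b|].
  - by elim/ord2P => y i a; rewrite inE => /eqP ->; rewrite /T upd_inord.
  - by rewrite /T (on_pair_multilinear Bl') (bilin_r Bl).
  - exact: (right_comp_multilinear Bl Bl').
rewrite (tens_cop_precomp rhoP qP u v TP).
exact: (tens_precomp_comp rho u (on_pair B') (q v) (bilin_r Bl (v (inord 0)))).
Qed.

Lemma tens_cop_right_outer u B B' v :
  bilinear_op B -> bilinear_op B' -> invariant_op B' ->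
  tens_precomp rho (tens_cop 2 2 [:: [:: 0]; [:: 1; 2]]%N u) (right_comp B B') v
  = tens_precomp rho u (on_pair B)
      (pair2 (v (inord 0)) (B' (v (inord 1)) (v (inord 2)))).
Proof.
move=> Bl Bl' Bi'.
pose q (y : 'I_3 -> A) := pair2 (y (inord 0)) (B' (y (inord 1)) (y (inord 2))).
have qP : equivariant (rho := rho) [:: [:: 0]; [:: 1; 2]]%N q.
  split=> [|k k' y i a].
    by elim/ord2P => y x; rewrite big_cons ?big_cons big_nil addr0 /q
      ?pair2_0 ?pair2_1 ?Bi' !upd_inord.
  elim/ord2P: k; elim/ord2P: k' => // _; rewrite !inE.
    by move=> /eqP ->; rewrite /q !pair2_1 !upd_inord.
  by case/orP => /eqP ->; rewrite /q !pair2_0 upd_inord.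
have TP : compatible [:: [:: 0]; [:: 1; 2]]%N q (fun=> on_pair B).
  split=> // [y|]; first exact: on_pair_multilinear.
  exact: (right_comp_multilinear Bl Bl').
exact: (tens_cop_precomp rhoP qP u v TP).
Qed.

(** If [g] kills [c], then [u] acts on [B (c, y)] through its image under the
    counit in the first factor. *)
Lemma tens_cop_counitl u B c y : bilinear_op B -> (forall x, rho x c = 0) ->
  tens_precomp rho (tens_cop 2 0 [:: [::]; [:: 0]]%N u) (fun v => B c (v (inord 0))) y
  = tens_precomp rho u (on_pair B) (pair2 c (y (inord 0))).
Proof.
move=> Bl c0; pose q (v : 'I_1 -> A) := pair2 c (v (inord 0)).
have qP : equivariant (rho := rho) [:: [::]; [:: 0]]%N q.
  split=> [|k k' v i a].
    by elim/ord2P => v x; rewrite ?big_nil ?big_seq1 /q ?pair2_0 ?pair2_1 ?upd_inord.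
  by elim/ord2P: k; elim/ord2P: k'.
have TP : compatible [:: [::]; [:: 0]]%N q (fun=> on_pair B).
  split=> // [v|]; first exact: on_pair_multilinear.
  move=> i v d a b; have -> : i = inord 0 by rewrite !ord1.
  rewrite /on_pair /q !pair2_0 !pair2_1.
  by rewrite !upd_inord //= (bilin_r Bl).
exact: (tens_cop_precomp rhoP qP u y TP).
Qed.

Lemma tens_cop_counitr u B c y : bilinear_op B -> (forall x, rho x c = 0) ->
  tens_precomp rho (tens_cop 2 0 [:: [:: 0]; [::]]%N u) (fun v => B (v (inord 0)) c) y
  = tens_precomp rho u (on_pair B) (pair2 (y (inord 0)) c).
Proof.
move=> Bl c0; pose q (v : 'I_1 -> A) := pair2 (v (inord 0)) c.
have qP : equivariant (rho := rho) [:: [:: 0]; [::]]%N q.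
  split=> [|k k' v i a].
    by elim/ord2P => v x; rewrite ?big_nil ?big_seq1 /q ?pair2_0 ?pair2_1 ?upd_inord.
  by elim/ord2P: k; elim/ord2P: k'.
have TP : compatible [:: [:: 0]; [::]]%N q (fun=> on_pair B).
  split=> // [v|]; first exact: on_pair_multilinear.
  move=> i v d a b; have -> : i = inord 0 by rewrite !ord1.
  rewrite /on_pair /q !pair2_0 !pair2_1.
  by rewrite !upd_inord //= (bilin_l Bl).
exact: (tens_cop_precomp rhoP qP u y TP).
Qed.

End BinaryOperations.

Arguments invariant_op {K g A} rho B.

(** * Twisting a formal multiplication *)

Section TwistedMultiplications.
Context {K : fieldType} {g : lieAlgebra K} {A : lmodType K}.
Context {rho : g -> A -> A} (rhoP : representation rho).
Implicit Types m mu : nat -> A -> A -> A.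

Definition formal_op m : ('I_2 -> A) -> fps A := fun v n => on_pair (m n) v.

Definition bilinear_family m : Prop := forall n, bilinear_op (m n).

Definition assocl m := convolution (fun k i => left_comp (m k) (m i)).
Definition assocr m := convolution (fun k i => right_comp (m k) (m i)).

Definition act_after n b (T : ('I_n -> A) -> fps A) : ('I_n -> A) -> fps A :=
  fun v => fps_map (env_act rho b) (T v).

Lemma formal_op_multilinear m : bilinear_family m -> multilinear (formal_op m).
Proof.
by move=> mP i x c a b; apply/funext => n; exact: (on_pair_multilinear (mP n)).
Qed.

Lemma assocl_multilinear m : bilinear_family m -> multilinear (assocl m).
Proof.
by move=> mP; apply: convolution_multilinear => k i; exact: left_comp_multilinear.
Qed.

Lemma assocr_multilinear m : bilinear_family m -> multilinear (assocr m).
Proof.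
by move=> mP; apply: convolution_multilinear => k i; exact: right_comp_multilinear.
Qed.

Lemma act_after_precomp n b (u : fps (tens g n)) T :
  act_after b (fps_precomp rho u T) = fps_precomp rho u (act_after b T).
Proof.
apply/funext => v; apply/funext => k.
rewrite /act_after /fps_map !fps_precompE (linear_sumE (env_act_linear rhoP b)).
apply: eq_bigr => j _.
by rewrite (tens_precomp_comp rho (u j) _ v (env_act_linear rhoP b)).
Qed.

Lemma Delta_inj (x : g) : Delta (env_inj x) = primitive_sum (m := 1) [:: 0; 1]%N x.
Proof. exact: cop_pclass. Qed.

(** Elements of [g] being primitive, invariance under them is the Leibniz
    rule. *)
Lemma invariant_op_of_Delta m : bilinear_family m ->
  (forall b, act_after b (formal_op m)
     = fps_precomp rho (fps_cst (Delta b)) (formal_op m)) ->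
  forall n, invariant_op rho (m n).
Proof.
move=> mP inv n x a b.
have := congr1 (fun T => T (pair2 a b) n) (inv (env_inj x)).
rewrite /act_after /fps_map (env_act_inj rhoP).
rewrite (fps_precomp_cst rhoP) ?Delta_inj; last exact: formal_op_multilinear.
rewrite (tens_precomp_sum rhoP); last exact: on_pair_multilinear.
rewrite big_cons big_seq1 !(tens_precomp_slot rhoP); try exact: on_pair_multilinear.
rewrite !(env_act_inj rhoP) inord0 (inord_max 1) upd_pair2_0 upd_pair2_1.
by rewrite /on_pair !pair2_0 !pair2_1.
Qed.

Context (F : fps (tens g 2)) (F0 : F 0%N = 1).
Context (m mu : nat -> A -> A -> A).
Context (mP : bilinear_family m) (muP : bilinear_family mu).
Context (mu_twist : formal_op mu = fps_precomp rho F (formal_op m)).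

Let muE n x y : mu n x y =
  \sum_(l < n.+1) tens_precomp rho (F l) (on_pair (m (n - l)%N)) (pair2 x y).
Proof.
transitivity (formal_op mu (pair2 x y) n) => //.
by rewrite mu_twist fps_precompE.
Qed.

Lemma untwist_formal_op : formal_op m = fps_precomp rho F^-1 (formal_op mu).
Proof.
have Fu := fps_unit_coef0 F0.
rewrite mu_twist -(fps_precompM rhoP) ?divrr ?(fps_precomp1 rhoP) //;
exact: formal_op_multilinear.
Qed.

(** [F * Delta b * F^-1] is the twisted coproduct: precomposing with [F] turns
    invariance for it into invariance for [Delta]. *)
Lemma twist_Delta :
  (forall b, act_after b (formal_op mu)
     = fps_precomp rho (fps_cst (Delta b)) (formal_op mu)) <->
  (forall b, act_after b (formal_op m)
     = fps_precomp rho (F * fps_cst (Delta b) * F^-1) (formal_op m)).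
Proof.
have Fu := fps_unit_coef0 F0; have ml := formal_op_multilinear mP.
split=> inv b.
  rewrite [in LHS]untwist_formal_op act_after_precomp inv mu_twist.
  rewrite -!(fps_precompM rhoP) ?mulrA //.
  exact: (fps_precomp_multilinear rhoP).
rewrite mu_twist act_after_precomp inv -!(fps_precompM rhoP) //.
by rewrite divrK.
Qed.

(** The inner multiplication is twisted before the outer one: the outer twist
    is absorbed through [Delta], which requires the inner multiplication to be
    the invariant one, [mu]. *)
Lemma assocl_twist : (forall n, invariant_op rho (mu n)) ->
  assocl mu = fps_precomp rho
    (fps_map (tens_cop 2 2 [:: [:: 0]; [:: 1]]%N) F
     * fps_map (tens_cop 2 2 [:: [:: 0; 1]; [:: 2]]%N) F) (assocl m).
Proof.
move=> inv; rewrite (fps_precompM rhoP); last exact: assocl_multilinear.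
rewrite (convolution_precomp_inner (S' := fun k i => left_comp (m k) (mu i))).
  rewrite (convolution_precomp_outer (S' := fun k i => left_comp (mu k) (mu i))) //.
  move=> k i v; rewrite [LHS]muE; apply: eq_bigr => l _.
  by rewrite (tens_cop_left_outer rhoP).
move=> k i v; rewrite [LHS](congr1 (fun a => m k a _) (muE _ _ _)).
rewrite (linear_sumE (bilin_l (mP k) _)); apply: eq_bigr => l _.
by rewrite (tens_cop_left_inner rhoP).
Qed.

Lemma assocr_twist : (forall n, invariant_op rho (mu n)) ->
  assocr mu = fps_precomp rho
    (fps_map (tens_cop 2 2 [:: [:: 1]; [:: 2]]%N) F
     * fps_map (tens_cop 2 2 [:: [:: 0]; [:: 1; 2]]%N) F) (assocr m).
Proof.
move=> inv; rewrite (fps_precompM rhoP); last exact: assocr_multilinear.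
rewrite (convolution_precomp_inner (S' := fun k i => right_comp (m k) (mu i))).
  rewrite (convolution_precomp_outer (S' := fun k i => right_comp (mu k) (mu i))) //.
  move=> k i v; rewrite [LHS]muE; apply: eq_bigr => l _.
  by rewrite (tens_cop_right_outer rhoP).
move=> k i v; rewrite [LHS](congr1 (m k _) (muE _ _ _)).
rewrite (linear_sumE (bilin_r (mP k) _)); apply: eq_bigr => l _.
by rewrite (tens_cop_right_inner rhoP).
Qed.

(** The equation for [Phi] makes the two associators of [mu], the right one
    precomposed with [Phi], the precompositions of those of [m] with one and
    the same element, which is invertible. *)
Lemma twist_associative (Phi : fps (tens g 3)) :
  fps_map (tens_cop 2 2 [:: [:: 0]; [:: 1]]%N) F
    * fps_map (tens_cop 2 2 [:: [:: 0; 1]; [:: 2]]%N) F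
  = fps_map (tens_cop 2 2 [:: [:: 1]; [:: 2]]%N) F
    * fps_map (tens_cop 2 2 [:: [:: 0]; [:: 1; 2]]%N) F * Phi ->
  (forall n, invariant_op rho (mu n)) ->
  (assocr m = assocl m <-> fps_precomp rho Phi (assocr mu) = assocl mu).
Proof.
move=> F_Phi inv; rewrite (assocl_twist inv) (assocr_twist inv).
rewrite -(fps_precompM rhoP) -?F_Phi; last exact: assocr_multilinear.
set Z := _ * _; have Zu : Z \is a GRing.unit.
  apply: fps_unit_coef0; rewrite /Z fps_coefM big_ord1 /fps_map F0.
  by rewrite !tens_cop1 // mulr1.
split=> [-> //|eqZ].
have al := assocl_multilinear mP; have ar := assocr_multilinear mP.
rewrite -[LHS](fps_precomp1 rhoP) // -[RHS](fps_precomp1 rhoP) //.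
by rewrite -(divrr Zu) (fps_precompM rhoP Z _ ar) eqZ -(fps_precompM rhoP Z _ al).
Qed.

Lemma twist_coef0 x y : mu 0%N x y = m 0%N x y.
Proof.
transitivity (formal_op mu (pair2 x y) 0%N) => //.
by rewrite mu_twist (fps_precomp_coef0 rhoP) //; exact: formal_op_multilinear.
Qed.

(** Precomposing [m (c, -)] with the counit image of [F], which is 1, changes
    nothing. *)
Lemma twist_constl n c y :
  fps_map (tens_cop 2 0 [:: [::]; [:: 0]]%N) F = 1 ->
  (forall x, rho x c = 0) -> mu n c y = m n c y.
Proof.
move=> F1 c0; pose T (v : 'I_1 -> A) : fps A := fun k => m k c (v (inord 0)).
have Tl : multilinear T.
  move=> i v d a b; apply/funext => k.
  have -> : i = inord 0 by rewrite !ord1.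
  by rewrite /T !upd_inord //= (bilin_r (mP k)).
transitivity (T (fun=> y) n) => //.
rewrite -[in RHS](fps_precomp1 rhoP Tl) -F1 fps_precompE muE.
by apply: eq_bigr => l _; rewrite (tens_cop_counitl rhoP).
Qed.

Lemma twist_constr n c x :
  fps_map (tens_cop 2 0 [:: [:: 0]; [::]]%N) F = 1 ->
  (forall z, rho z c = 0) -> mu n x c = m n x c.
Proof.
move=> F1 c0; pose T (v : 'I_1 -> A) : fps A := fun k => m k (v (inord 0)) c.
have Tl : multilinear T.
  move=> i v d a b; apply/funext => k.
  have -> : i = inord 0 by rewrite !ord1.
  by rewrite /T !upd_inord //= (bilin_l (mP k)).
transitivity (T (fun=> x) n) => //.
rewrite -[in RHS](fps_precomp1 rhoP Tl) -F1 fps_precompE muE.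
by apply: eq_bigr => l _; rewrite (tens_cop_counitr rhoP).
Qed.

End TwistedMultiplications.

(** * Bidifferential operators *)

Section DifferentialOperators.
Context {R : realType} {X : funSpace R} {U : opens X}.
Implicit Types (E D : sect U -> sect U) (a f : sect U).

Lemma sect_scalerAr (c : R[i]) a f : c *: (a * f) = a * (c *: f).
Proof.
apply: sect_ext => x _.
rewrite [LHS](_ : _ = c * (a x * f x)) // [RHS](_ : _ = a x * (c * f x)) //.
exact: mulrCA.
Qed.

Lemma diff_op_le_eq n E E' : E =1 E' -> diff_op_le n E -> diff_op_le n E'.
Proof. by move=> /funext ->. Qed.

Lemma diff_op_le0 n : diff_op_le n (fun=> 0 : sect U).
Proof.
elim: n => [|n IHn] a /=; first by move=> x; rewrite mulr0 subr0.
by apply: diff_op_le_eq IHn => x; rewrite mulr0 subr0.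
Qed.

Lemma diff_op_leS n E : diff_op_le n E -> diff_op_le n.+1 E.
Proof.
elim: n E => [|n IHn] E En a; last exact: IHn.
by apply: diff_op_le_eq (diff_op_le0 0) => x; rewrite En.
Qed.

Lemma diff_op_le_widen n p E : (n <= p)%N -> diff_op_le n E -> diff_op_le p E.
Proof.
by move=> /subnK <-; elim: (p - n)%N => // q IHq /IHq; exact: diff_op_leS.
Qed.

Lemma diff_op_leD n E E' :
  diff_op_le n E -> diff_op_le n E' -> diff_op_le n (fun f => E f + E' f).
Proof.
elim: n E E' => [|n IHn] E E' En En' a /=.
  by move=> x; rewrite mulrDr opprD addrACA En En' addr0.
apply: diff_op_le_eq (IHn _ _ (En a) (En' a)) => x.
by rewrite mulrDr opprD addrACA.
Qed.

Lemma diff_op_leZ n c E : diff_op_le n E -> diff_op_le n (fun f => c *: E f).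
Proof.
elim: n E => [|n IHn] E En a /=.
  by move=> x; rewrite -sect_scalerAr -scalerBr En scaler0.
by apply: diff_op_le_eq (IHn _ (En a)) => x; rewrite -sect_scalerAr -scalerBr.
Qed.

Lemma diff_op_le_mul n a E : diff_op_le n E -> diff_op_le n (fun f => E (a * f)).
Proof.
elim: n E => [|n IHn] E En b /=; first by move=> x; rewrite mulrCA En.
by apply: diff_op_le_eq (IHn _ (En b)) => x; rewrite (mulrCA b).
Qed.

(** The commutator of [E] after [D] with [a] is [E] after multiplication by
    [D a], plus the commutator of [E] with [a] after [D], of smaller order. *)
Lemma diff_op_le_derivation n E D :
  (forall f f', E (f + f') = E f + E f') ->
  (forall f f', D (f * f') = D f * f' + f * D f') ->
  diff_op_le n E -> diff_op_le n.+1 (fun f => E (D f)).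
Proof.
move=> + DP; elim: n E => [|n IHn] E Eadd En a;
  have adE x : E (D (a * x)) - a * E (D x) =
      E (D a * x) + (E (a * D x) - a * E (D x)) by rewrite DP Eadd addrA.
  apply: diff_op_le_eq (diff_op_le_mul (D a) En) => x.
  by rewrite adE En addr0.
have Eadd' f f' : E (a * (f + f')) - a * E (f + f') =
    (E (a * f) - a * E f) + (E (a * f') - a * E f').
  by rewrite mulrDr !Eadd mulrDr opprD addrACA.
apply: diff_op_le_eq
  (diff_op_leD (diff_op_le_mul (D a) En) (IHn _ Eadd' (En a))) => x.
by rewrite adE.
Qed.

End DifferentialOperators.

Section BidifferentialOperators.
Context {R : realType} {X : funSpace R}.
Implicit Types (B : bioperator X) (D : operator X).

Definition bizero : bioperator X := fun U _ _ => 0.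
Definition biadd B B' : bioperator X := fun U x y => B U x y + B' U x y.
Definition biscale c B : bioperator X := fun U x y => c *: B U x y.
Definition bicompl D B : bioperator X := fun U x y => B U (D U x) y.
Definition bicompr D B : bioperator X := fun U x y => B U x (D U y).

(** The closure properties that carry a class of bilinear sheaf operators to
    their precompositions with elements of [tens g 2]; they are shared by
    [sheaf_bilinear] and [bidifferential]. *)
Record twist_stable (P : bioperator X -> Prop) : Prop := TwistStable {
  ts_bilinear : forall B, P B -> sheaf_bilinear B;
  ts_zero : P bizero;
  ts_add : forall B B', P B -> P B' -> P (biadd B B');
  ts_scale : forall c B, P B -> P (biscale c B);
  ts_compl : forall D B, vector_field D -> P B -> P (bicompl D B);
  ts_compr : forall D B, vector_field D -> P B -> P (bicompr D B)
}.

Lemma sheaf_bilinear_stable : twist_stable (@sheaf_bilinear R X).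
Proof.
split=> //.
- by split=> // *; move=> ? ? ? /=; rewrite scaler0 addr0.
- move=> B B' [Bl Br Bs] [Bl' Br' Bs']; split.
  + by move=> U y c a b; rewrite /biadd Bl Bl' scalerDr addrACA.
  + by move=> U y c a b; rewrite /biadd Br Br' scalerDr addrACA.
  + move=> U V VU x y x' y' xx' yy' z Vz.
    by congr (_ + _); [exact: (Bs U V) | exact: (Bs' U V)].
- move=> c B [Bl Br Bs]; split.
  + by move=> U y d a b; rewrite /biscale Bl scalerDr !scalerA mulrC.
  + by move=> U y d a b; rewrite /biscale Br scalerDr !scalerA mulrC.
  + move=> U V VU x y x' y' xx' yy' z Vz.
    by congr (c * _); exact: (Bs U V).
- move=> D B [Dl _ Ds] [Bl Br Bs]; split.
  + by move=> U y c a b; rewrite /bicompl Dl Bl.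
  + by move=> U y c a b; exact: Br.
  + move=> U V VU x y x' y' xx' yy'; apply: Bs => //; exact: Ds.
- move=> D B [Dl _ Ds] [Bl Br Bs]; split.
  + by move=> U y c a b; exact: Bl.
  + by move=> U y c a b; rewrite /bicompr Dl Br.
  + move=> U V VU x y x' y' xx' yy'; apply: Bs => //; exact: Ds.
Qed.

Lemma bidifferential_stable : twist_stable (@bidifferential R X).
Proof.
have ss := sheaf_bilinear_stable.
split.
- by move=> B [].
- split=> [|x]; first exact: (ts_zero ss).
  exists 0%N, (Opens openT); split=> // W _ f.
  by split; exact: diff_op_le0.
- move=> B B' [Bs Bd] [Bs' Bd']; split=> [|x]; first exact: (ts_add ss).
  have [n [V [Vx nB]]] := Bd x; have [n' [V' [V'x nB']]] := Bd' x.
  exists (maxn n n'), (Opens (openI (opensP V) (opensP V'))); split=> // W WV f.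
  have [nl nr] := nB W (fun y Wy => (WV y Wy).1) f.
  have [nl' nr'] := nB' W (fun y Wy => (WV y Wy).2) f.
  split; apply: diff_op_leD.
  + exact: diff_op_le_widen (leq_maxl n n') nl.
  + exact: diff_op_le_widen (leq_maxr n n') nl'.
  + exact: diff_op_le_widen (leq_maxl n n') nr.
  + exact: diff_op_le_widen (leq_maxr n n') nr'.
- move=> c B [Bs Bd]; split=> [|x]; first exact: (ts_scale ss).
  have [n [V [Vx nB]]] := Bd x; exists n, V; split=> // W WV f.
  by have [nl nr] := nB W WV f; split; exact: diff_op_leZ.
- move=> D B DP [Bs Bd]; split=> [|x]; first exact: (ts_compl ss).
  have [n [V [Vx nB]]] := Bd x; exists n.+1, V; split=> // W WV f.
  have [nl _] := nB W WV (D W f); have [_ nr] := nB W WV f.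
  split; first exact: diff_op_leS.
  apply: diff_op_le_derivation nr; last exact: vf_leibniz.
  exact: linear_add (sb_linearl Bs f).
- move=> D B DP [Bs Bd]; split=> [|x]; first exact: (ts_compr ss).
  have [n [V [Vx nB]]] := Bd x; exists n.+1, V; split=> // W WV f.
  have [_ nr] := nB W WV (D W f); have [nl _] := nB W WV f.
  split; last exact: diff_op_leS.
  apply: diff_op_le_derivation nl; last exact: vf_leibniz.
  exact: linear_add (sb_linearr Bs f).
Qed.

Lemma bidifferential_product B : sheaf_bilinear B ->
  (forall U (x y : sect U), B U x y = x * y) -> bidifferential B.
Proof.
move=> Bs BE; split=> // x; exists 0%N, (Opens openT); split=> // W _ f.
split=> a /= y; rewrite !BE; first by rewrite mulrCA subrr.
by rewrite mulrA subrr.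
Qed.

End BidifferentialOperators.

Section TwistedOperators.
Context {R : realType} {X : funSpace R} {g : lieAlgebra R[i]}.
Context {rho : g -> operator X} (rho_field : forall x, vector_field (rho x)).
Local Notation rho_on U := (fun x => @rho x U).

Lemma bioperator_transfer (P : bioperator X -> Prop) (B B' : bioperator X) :
  P B -> (forall U x y, B' U x y = B U x y) -> P B'.
Proof.
move=> PB B'B; suff -> : B' = B by [].
apply/functional_extensionality_dep => U.
by apply/funext => x; apply/funext => y.
Qed.

(** Exchanging the arguments reduces the action on the second one to the action
    on the first one. *)
Lemma twist_stable_flip (P : bioperator X -> Prop) : twist_stable P ->
  twist_stable (fun B => P (fun U x y => B U y x)).
Proof.
case=> Pb P0 PD PZ Pl Pr; split=> //.
- move=> B /Pb [Bl Br Bs]; split=> [U y|U x|U V VU x y x' y' xx' yy'].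
  + exact: Br.
  + exact: Bl.
  + exact: (Bs U V VU y x y' x').
- by move=> B B'; exact: (PD (fun U x y => B U y x) (fun U x y => B' U y x)).
- by move=> c B; exact: (PZ c (fun U x y => B U y x)).
- by move=> D B; exact: (Pr D (fun U x y => B U y x)).
- by move=> D B; exact: (Pl D (fun U x y => B U y x)).
Qed.

Lemma twist_stable_actl (P : bioperator X -> Prop) (e : aexpr R[i] g) B :
  twist_stable P -> P B -> P (fun U x y => B U (aact (rho_on U) e x) y).
Proof.
move=> PP; elim: e B => [x||| e IHe|c e IHe|e IHe f IHf|e IHe f IHf] B PB /=;
  have [Bl Br _] := ts_bilinear PP PB.
- exact: (ts_compl PP).
- apply: (bioperator_transfer (B := @bizero R X)); first exact: (ts_zero PP).
  by move=> U x y; rewrite (linear_zero (Bl U y)).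
- exact: PB.
- apply: (bioperator_transfer
      (B := biscale (-1) (fun U x y => B U (aact (rho_on U) e x) y))).
    exact/(ts_scale PP)/IHe.
  by move=> U x y; rewrite /biscale (linear_opp (Bl U y)) scaleN1r.
- apply: (bioperator_transfer
      (B := biscale c (fun U x y => B U (aact (rho_on U) e x) y))).
    exact/(ts_scale PP)/IHe.
  by move=> U x y; rewrite /biscale (linear_scale (Bl U y)).
- apply: (bioperator_transfer (B := biadd (fun U x y => B U (aact (rho_on U) e x) y)
      (fun U x y => B U (aact (rho_on U) f x) y))).
    by apply: (ts_add PP); [exact: IHe | exact: IHf].
  by move=> U x y; rewrite /biadd (linear_add (Bl U y)).
- exact: (IHf (fun U x y => B U (aact (rho_on U) e x) y)) (IHe _ PB).
Qed.

Lemma twist_stable_precomp (P : bioperator X -> Prop)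
    (t : aexpr R[i] ('I_2 * env g)) B : twist_stable P -> P B ->
  P (fun U x y => precomp (rho_on U) t (on_pair (@B U)) (pair2 x y)).
Proof.
move=> PP; elim: t B => [[k b]||| t IHt|c t IHt|t IHt u IHu|t IHt u IHu] B PB.
- elim/ord2P: k.
    apply: (bioperator_transfer (B := fun U x y => B U (env_act (rho_on U) b x) y)).
      exact: (twist_stable_actl (prepr (P := env_presentation g) b) PP PB).
    by move=> U x y; rewrite precomp_gen upd_pair2_0.
  apply: (bioperator_transfer (B := fun U x y => B U x (env_act (rho_on U) b y))).
    exact: (twist_stable_actl (B := fun U x y => B U y x)
      (prepr (P := env_presentation g) b) (twist_stable_flip PP) PB).
  by move=> U x y; rewrite precomp_gen upd_pair2_1.
- exact: (ts_zero PP).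
- exact: PB.
- apply: (bioperator_transfer (B := biscale (-1)
      (fun U x y => precomp (rho_on U) t (on_pair (@B U)) (pair2 x y)))).
    exact/(ts_scale PP)/IHt.
  by move=> U x y; rewrite /biscale scaleN1r.
- exact/(ts_scale PP)/IHt.
- by apply: (ts_add PP); [exact: IHt | exact: IHu].
- pose B' : bioperator X :=
    fun U x y => precomp (rho_on U) t (on_pair (@B U)) (pair2 x y).
  apply: (bioperator_transfer (B := fun U x y =>
      precomp (rho_on U) u (on_pair (@B' U)) (pair2 x y))).
    exact/IHu/IHt.
  move=> U x y /=; congr (precomp _ u _ _); apply/funext => v.
  by rewrite /on_pair /B' pair2_eta.
Qed.

Lemma twist_stable_fps (P : bioperator X -> Prop) (u : fps (tens g 2))
    (mu : nat -> bioperator X) n : twist_stable P -> (forall k, P (mu k)) ->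
  P (fun U x y =>
       fps_precomp (rho_on U) u (formal_op (fun k => @mu k U)) (pair2 x y) n).
Proof.
move=> PP Pmu.
pose term (j : nat) : bioperator X := fun U x y =>
  tens_precomp (rho_on U) (u j) (on_pair (@mu (n - j)%N U)) (pair2 x y).
have Pterm j : P (term j) by exact: twist_stable_precomp.
apply: (bioperator_transfer (B := fun U x y => \sum_(j < n.+1) term j U x y)).
  elim: n.+1 => [|p IHp].
    apply: (bioperator_transfer (B := @bizero R X)); first exact: (ts_zero PP).
    by move=> U x y; rewrite big_ord0.
  apply: (bioperator_transfer (B := biadd
    (fun U x y => \sum_(j < p) term j U x y) (term p))); first exact: (ts_add PP).
  by move=> U x y; rewrite big_ord_recr.
by move=> U x y; rewrite fps_precompE.
Qed.

End TwistedOperators.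

(** * Quantizations *)

Section TwistedQuantizations.
Context {R : realType} {k : kind} {G : lieGroup R} {g : lieAlgebra R[i]}.
Context {lam : g -> operator G} (M : gManifold k lam).
Context {r : seq (g * g)} (Q : quantumGroup r).
Implicit Types (m mu : hmult M) (u : fps (tens g 2)) (U : opens M).
Local Notation rho_on U := (fun z => gm_rho M z U).
Local Notation ops_on U mu := (fun n => mu n U).

Lemma gm_representation U : representation (rho_on U).
Proof.
split=> [x|f|x y f]; last exact: gm_rho_bracket.
- exact: (vf_linear (gm_rho_field M x) (U := U)).
- exact: gm_rho_linear.
Qed.

Lemma vector_field_cst (X : funSpace R) (D : operator X) (V : opens X) (c : R[i]) :
  vector_field D -> D V (c *: (1 : sect V)) = 0.
Proof.
move=> DP; rewrite (linear_scale (vf_linear DP (U := V))).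
suff -> : D V (1 : sect V) = 0 by rewrite scaler0.
apply: (addrI (D V (1 : sect V))); rewrite addr0.
have := vf_leibniz DP (1 : sect V) 1; rewrite !mulr1 mul1r; exact: esym.
Qed.

Lemma hmult_bilinear mu U : is_hmult mu -> bilinear_family (ops_on U mu).
Proof.
by move=> muP n; have [Bl Br _] := muP n; split; [exact: Bl | exact: Br].
Qed.

Lemma hext_cstl mu U (x : sect U) (b : fps (sect U)) n : is_hmult mu ->
  hext mu (fps_cst x) b n = \sum_(j < n.+1) mu (n - j)%N U x (b j).
Proof.
move=> muP; rewrite /hext big_ord_recl /= [X in _ + X]big1 ?addr0; last first.
  move=> i _; apply: big1 => j _.
  by rewrite (linear_zero (sb_linearl (muP _) _)).
by rewrite subn0.
Qed.

Lemma hext_cstr mu U (a : fps (sect U)) (z : sect U) n : is_hmult mu ->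
  hext mu a (fps_cst z) n = \sum_(i < n.+1) mu (n - i)%N U (a i) z.
Proof.
move=> muP; apply: eq_bigr => i _; rewrite big_ord_recl /= subn0 big1 ?addr0 //.
by move=> j _; rewrite (linear_zero (sb_linearr (muP _) _)).
Qed.

Lemma assocr_hext mu U (v : 'I_3 -> sect U) : is_hmult mu ->
  assocr (ops_on U mu) v =
  hext mu (fps_cst (v ord0)) (hval mu (v (inord 1)) (v ord_max)).
Proof.
move=> muP; apply/funext => n; rewrite hext_cstl // -inord0 -(inord_max 2).
by [].
Qed.

Lemma assocl_hext mu U (v : 'I_3 -> sect U) : is_hmult mu ->
  assocl (ops_on U mu) v =
  hext mu (hval mu (v ord0) (v (inord 1))) (fps_cst (v ord_max)).
Proof.
move=> muP; apply/funext => n; rewrite hext_cstr // -inord0 -(inord_max 2).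
by [].
Qed.

Lemma triple_inord1 (A : Type) (x y z : A) : tnth [tuple x; y; z] (inord 1) = y.
Proof. by rewrite (tnth_nth x) /= inordK. Qed.

Lemma triple_eta (A : Type) (v : 'I_3 -> A) :
  tnth [tuple v ord0; v (inord 1); v ord_max] = v.
Proof. by apply/funext; elim/ord3P => //; rewrite triple_inord1. Qed.

Lemma associative_multE m : is_hmult m ->
  associative_mult m <-> forall U, assocr (ops_on U m) = assocl (ops_on U m).
Proof.
move=> mP; split=> [mA U|mA U x y z].
  by apply/funext => v; rewrite assocr_hext // assocl_hext // mA.
have := congr1 (fun T => T (tnth [tuple x; y; z])) (mA U).
by rewrite assocr_hext // assocl_hext // triple_inord1.
Qed.

Lemma Phi_associativeE mu : is_hmult mu ->
  Phi_associative Q mu <->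
  forall U, fps_precomp (rho_on U) (qPhi Q) (assocr (ops_on U mu))
    = assocl (ops_on U mu).
Proof.
move=> muP.
have rE U : assocr (ops_on U mu) =
    fun v => hext mu (fps_cst (v ord0)) (hval mu (v (inord 1)) (v ord_max)).
  by apply/funext => v; exact: assocr_hext.
split=> [muA U|muA U x y z].
  apply/funext => v; rewrite rE assocl_hext //.
  by have := muA U (v ord0) (v (inord 1)) (v ord_max); rewrite triple_eta.
have := congr1 (fun T => T (tnth [tuple x; y; z])) (muA U).
by rewrite rE assocl_hext // triple_inord1.
Qed.

Lemma act_after_pairE mu U u b :
  (forall x y : sect U, hact b (hval mu x y) = hval_tens mu u x y) <->
  act_after (rho := rho_on U) b (formal_op (ops_on U mu))
  = fps_precomp (rho_on U) u (formal_op (ops_on U mu)).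
Proof.
split=> [inv|inv x y]; last exact: (congr1 (fun T => T (pair2 x y)) inv).
by apply/funext => v; rewrite -(pair2_eta v); exact: inv.
Qed.

Definition twist_by u mu : hmult M := fun n U x y => hval_tens mu u x y n.

Lemma twist_by_formal_op u mu U :
  formal_op (ops_on U (twist_by u mu)) =
  fps_precomp (rho_on U) u (formal_op (ops_on U mu)).
Proof.
apply/funext => v; rewrite -[in RHS](pair2_eta v).
by apply/funext => n.
Qed.

Lemma twist_by_stable (P : bioperator M -> Prop) u mu : twist_stable P ->
  (forall n, P (mu n)) -> forall n, P (twist_by u mu n).
Proof.
move=> PP Pmu n.
exact: (twist_stable_fps (gm_rho_field M) u n PP Pmu).
Qed.

Lemma is_hmult_twist_by u mu : is_hmult mu -> is_hmult (twist_by u mu).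
Proof. exact: twist_by_stable (@sheaf_bilinear_stable _ _). Qed.

(** The relation [mu = m . F], equivalent to [m = mu . F^-1] and common to both
    directions of the correspondence. *)
Definition linked m mu : Prop := forall U,
  formal_op (ops_on U mu) = fps_precomp (rho_on U) (qF Q) (formal_op (ops_on U m)).

Lemma linked_twist mu : is_hmult mu -> linked (twist Q mu) mu.
Proof.
move=> muP U; have ml := formal_op_multilinear (hmult_bilinear U muP).
rewrite (twist_by_formal_op (qF Q)^-1 mu) -(fps_precompM (gm_representation U)) //.
rewrite mulVr; last exact: fps_unit_coef0 (qF0 Q).
by rewrite (fps_precomp1 (gm_representation U)).
Qed.

Lemma linked_twist_by m : linked m (twist_by (qF Q) m).
Proof. by move=> U; exact: twist_by_formal_op. Qed.

Lemma hmult_formal_op_inj m mu :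
  (forall U, formal_op (ops_on U m) = formal_op (ops_on U mu)) -> m = mu.
Proof.
move=> eq_m; apply/funext => n; apply/functional_extensionality_dep => U.
apply/funext => x; apply/funext => y.
exact: (congr1 (fun T => T (pair2 x y) n) (eq_m U)).
Qed.

Lemma linked_twistE m mu : is_hmult m -> linked m mu -> twist Q mu = m.
Proof.
move=> mP mmu; apply: hmult_formal_op_inj => U.
rewrite (twist_by_formal_op (qF Q)^-1 mu).
by rewrite -(untwist_formal_op (gm_representation U) (qF0 Q)
  (hmult_bilinear U mP) (mmu U)).
Qed.

Section Linked.
Context (m mu : hmult M) (mP : is_hmult m) (muP : is_hmult mu) (mmu : linked m mu).
Let mb U := hmult_bilinear U mP.
Let mub U := hmult_bilinear U muP.

Lemma linked_invariant : U_invariant mu <-> Uh_invariant Q m.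
Proof.
have tw U := twist_Delta (gm_representation U) (qF0 Q) (mb U) (mmu U).
split=> inv b U; apply/act_after_pairE.
  apply: (tw U).1 => {}b; exact: (act_after_pairE mu U _ b).1 (inv b U).
apply: (tw U).2 => {}b; exact: (act_after_pairE m U _ b).1 (inv b U).
Qed.

Lemma linked_associative : U_invariant mu ->
  associative_mult m <-> Phi_associative Q mu.
Proof.
move=> inv; rewrite associative_multE // Phi_associativeE //.
have tw U := twist_associative (gm_representation U) (qF0 Q) (mb U) (mub U) (mmu U)
  (qF_Phi Q).
have invU U n : invariant_op (rho_on U) (@mu n U).
  apply: (invariant_op_of_Delta (gm_representation U) (mub U)) => b.
  exact: (act_after_pairE mu U _ b).1 (inv b U).
by split=> mA U; apply/(tw U).
Qed.

Lemma linked_vanish n : vanishes_on_constants (mu n) <-> vanishes_on_constants (m n).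
Proof.
have c0 U (c : R[i]) x : gm_rho M x U (c *: (1 : sect U)) = 0.
  exact: vector_field_cst (gm_rho_field M x).
have El U c f : @mu n U (c *: (1 : sect U)) f = @m n U (c *: (1 : sect U)) f.
  exact: (twist_constl (gm_representation U) (mb U) (mmu U) _ _
    (qF_counitl Q) (c0 U c)).
have Er U c f : @mu n U f (c *: (1 : sect U)) = @m n U f (c *: (1 : sect U)).
  exact: (twist_constr (gm_representation U) (mb U) (mmu U) _ _
    (qF_counitr Q) (c0 U c)).
by split=> van U c f; have := van U c f; rewrite El Er.
Qed.

Lemma linked_product U x y : @mu 0%N U x y = @m 0%N U x y.
Proof. exact: (twist_coef0 (gm_representation U) (qF0 Q) (mb U) (mmu U)). Qed.

End Linked.

(** The product itself is bidifferential, of order 0 in each argument, so that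
    all the coefficients of a deformation are. *)
Lemma deformation_bidifferential mu : is_hmult mu -> is_deformation mu ->
  forall n, bidifferential (mu n).
Proof.
move=> muP [mu0 mud] [|n]; first exact: bidifferential_product.
by have [] := mud n.+1.
Qed.

Lemma linked_deformation m mu : is_hmult m -> linked m mu ->
  (is_deformation m -> (forall n, bidifferential (mu n)) -> is_deformation mu) /\
  (is_deformation mu -> (forall n, bidifferential (m n)) -> is_deformation m).
Proof.
move=> mP mmu; split=> -[d0 dn] bd; split=> [U x y|n n0].
- by rewrite (linked_product mP mmu).
- by split=> //; apply/(linked_vanish mP mmu); have [] := dn n n0.
- by rewrite -(linked_product mP mmu).
- by split=> //; apply/(linked_vanish mP mmu); have [] := dn n n0.
Qed.

End TwistedQuantizations.

Theorem proposition3p1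
    (R : realType)
    (G : lieGroup R) (g : lieAlgebra R[i]) (lam : g -> operator G)
    (G_lie : lie_algebra_of lam)
    (G_connected : connected [set: G])
    (g_semisimple : semisimple g)
    (k : kind) (M : gManifold k lam)
    (r : seq (g * g)) (r_rmatrix : classical_rmatrix r)
    (Q : quantumGroup r) :
  (forall mu : hmult M, is_hmult mu -> U_invariant mu -> Phi_associative Q mu ->
     [/\ is_hmult (twist Q mu), associative_mult (twist Q mu)
       & Uh_invariant Q (twist Q mu)]) /\
  set_bij [set mu : hmult M | Phi_quantization Q mu /\ U_invariant mu]
          [set m : hmult M | quantization m /\ Uh_invariant Q m]
          (fun mu : hmult M => twist Q mu).
Proof.
have twisted (mu : hmult M) : is_hmult mu -> U_invariant mu -> Phi_associative Q mu ->
    [/\ is_hmult (twist Q mu), associative_mult (twist Q mu)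
      & Uh_invariant Q (twist Q mu)].
  move=> muP inv muA.
  have mP : is_hmult (twist Q mu) by exact: is_hmult_twist_by.
  have mmu := linked_twist Q muP.
  split=> //; first exact/(linked_associative mP muP mmu inv).
  exact/(linked_invariant mP mmu).
split; first exact: twisted.
split.
- move=> mu /= [[muP muA mud] inv].
  have [mP mA minv] := twisted mu muP inv muA.
  split=> //; split=> //.
  apply: (linked_deformation mP (linked_twist Q muP)).2 => //.
  apply: (twist_by_stable _ (@bidifferential_stable _ _)).
  exact: deformation_bidifferential.
- move=> mu mu'; rewrite !inE /= => -[[muP _ _] _] [[muP' _ _] _] tw.
  apply: hmult_formal_op_inj => U.
  by rewrite (linked_twist Q muP) tw -(linked_twist Q muP').
- move=> m /= [[mP mA md] minv].
  have mmu := linked_twist_by Q m.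
  have muP : is_hmult (twist_by (qF Q) m) by exact: is_hmult_twist_by.
  have inv : U_invariant (twist_by (qF Q) m) by exact/(linked_invariant mP mmu).
  exists (twist_by (qF Q) m); last exact: linked_twistE.
  split=> //; split=> //; first exact/(linked_associative mP muP mmu inv).
  apply: (linked_deformation mP mmu).1 => //.
  apply: (twist_by_stable _ (@bidifferential_stable _ _)).
  exact: deformation_bidifferential.
Qed.
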